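(* Let $k\ge 2$, $d\ge 2$, $n_0\ge 1$ and $n$ be integers, and let $\mathcal{T}_d^{n,n_0}$ be the class of all $k$-uniform supertrees with exactly $n$ vertices, exactly $n_0$ interior vertices, and with $d(v)\ge d$ for every interior vertex $v$. A $k$-uniform supertree $\mathcal{G}\in\mathcal{T}_d^{n,n_0}$ has the Faber-Krahn property within the class $\mathcal{T}_d^{n,n_0}$ if and only if it is an SLO-supertree having at most one interior vertex of degree $d'$ greater than $d$, while all other interior vertices have degree $d$. Furthermore, this supertree $\mathcal{G}$ is unique up to isomorphism.
   Context: Hypergraphs are finite, without multiple edges; a hypergraph is $k$-uniform if every edge has exactly $k$ vertices. The degree $d(v)$ is the number of edges containing $v$. Distinct vertices $u,v$ are adjacent ($u\sim v$) if some edge contains both. A path from $u_1$ to $u_{p+1}$ is an alternating sequence $(u_1,e_1,u_2,\dots,e_p,u_{p+1})$ of distinct vertices and distinct edges with $u_i,u_{i+1}\in e_i$; if $u_1=u_{p+1}$ (the other vertices and the edges being distinct) it is a cycle. $\mathrm{dist}(u,v)$ is the length of a shortest path. A supertree is a connected acyclic hypergraph (so any two edges share at most one vertex). For a supertree, the boundary $\partial V$ is the set of all vertices of degree one and $V^\circ=V\setminus\partial V$ is the set of interior vertices. The Laplacian of a $k$-uniform supertree is $L_{\mathcal{G}}f(u)=d(u)f(u)-\frac{1}{k-1}\sum_{v\sim u}f(v)$. A real $\lambda$ is a Dirichlet eigenvalue if there is a non-zero $f:V\to\mathbb{R}$ with $L_{\mathcal{G}}f(u)=\lambda f(u)$ for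 $u\in V^\circ$ and $f(u)=0$ for $u\in\partial V$. The first (smallest) Dirichlet eigenvalue is $$\lambda(\mathcal{G})=\min_f \frac{\sum_{\{u,v\}:\,u\sim v}\frac{1}{k-1}(f(u)-f(v))^2}{\sum_{v\in V}f(v)^2},$$ the minimum over non-zero $f:V\to\mathbb{R}$ with $f|_{\partial V}=0$ (the sum is over unordered pairs). $\mathcal{G}$ has the Faber-Krahn property within a class $\mathcal{C}$ if $\mathcal{G}\in\mathcal{C}$ and $\lambda(\mathcal{G})\le\lambda(\mathcal{H})$ for all $\mathcal{H}\in\mathcal{C}$. For a supertree with root $v_0$, the height is $h(v)=\mathrm{dist}(v,v_0)$; $u$ is a child of $v$ (and $v$ is the parent of $u$, which is unique) if $u\sim v$ and $h(u)=h(v)+1$. An SLO-ordering of a $k$-uniform supertree $\mathcal{G}$ with root $v_0$ is a well-ordering (total order) $\prec$ of the vertices such that: (S1) $u\prec v$ implies $h(u)\le h(v)$; (S2) if $u,v$ are the parents of $u_1,v_1$ respectively and $u\prec v$, then $u_1\prec v_1$; (S3) if $u\prec v$ and $u\in\partial V$, then $v\in\partial V$; (S4) if $e=\{u_1,\dots,u_k\}$ is an edge with $u_1\prec u_2\prec\cdots\prec u_k$, then there is no vertex $v\in V\setminus e$ with $u_i\prec v\prec u_{i+1}$ for some $2\le i\le k-1$; (S5) for $u,v\in V^\circ$, $u\prec v$ implies $d(u)\le d(v)$. An SLO-supertree is a supertree that has an SLO-ordering for some choice of root $v_0$. *)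

(* Defs.v *)
From mathcomp Require Import all_boot all_order all_algebra.
From mathcomp Require Import all_classical all_reals all_analysis.

Set Implicit Arguments.
Unset Strict Implicit.
Unset Printing Implicit Defensive.

Import Order.TTheory GRing.Theory Num.Theory.
Import numFieldNormedType.Exports.

Local Open Scope ring_scope.

Record hypergraph := Hypergraph {
  vert :> finType;
  edges : {set {set vert}}
}.

Section Hypergraph.
Variable G : hypergraph.
Implicit Types (u v w : G) (p : seq ({set G} * G)).

Definition k_uniform (k : nat) : Prop :=
  forall e : {set G}, e \in edges G -> #|e| = k.

Definition deg v : nat := #|[set e in edges G | v \in e]%SET|.

Definition adj u v : bool :=
  (u != v) && [exists e in edges G, (u \in e) && (v \in e)].

(* The alternating sequence (u_1, e_1, u_2, ..., e_p, u_{p+1}) is encoded by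
   u_1 and the list [:: (e_1, u_2); ...; (e_p, u_{p+1})]. *)
Fixpoint is_walk u p : bool :=
  if p is (e, v) :: p' then
    [&& e \in edges G, u \in e, v \in e & is_walk v p']
  else true.

Definition endpoint u p : G := last u (unzip2 p).

Definition is_path u p : bool :=
  [&& is_walk u p, uniq (u :: unzip2 p) & uniq (unzip1 p)].

(* Length 1 is excluded: otherwise (u, e, u) would be a cycle for every edge. *)
Definition is_cycle u p : bool :=
  [&& (1 < size p)%N, is_walk u p, endpoint u p == u,
      uniq (unzip2 p) & uniq (unzip1 p)].

Definition hconnected : Prop :=
  forall u v, exists p, is_path u p /\ endpoint u p = v.

Definition hacyclic : Prop := forall u p, ~~ is_cycle u p.

Definition supertree : Prop := hconnected /\ hacyclic.

(* A path has pairwise distinct vertices, hence length < #|G|; the first index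
   found in 0, ..., #|G| - 1 is the length of a shortest path, and #|G| stands
   for "no path". *)
Definition dist u v : nat :=
  find (fun m => [exists p : m.-tuple ({set G} * G),
                    is_path u p && (endpoint u p == v)])
       (iota 0 #|G|).

Definition boundary_vertices : {set G} := [set v | deg v == 1%N]%SET.
Definition interior_vertices : {set G} := (~: boundary_vertices)%SET.

Definition height (v0 v : G) : nat := dist v v0.

(* [is_parent v0 v u]: v is the parent of u for the root v0. *)
Definition is_parent (v0 v u : G) : bool :=
  adj u v && (height v0 u == (height v0 v).+1).

Definition strict_total_order (lt : rel G) : Prop :=
  [/\ irreflexive lt, transitive lt
    & forall u v, u != v -> lt u v || lt v u].

(* In the fourth clause the vertices of e are numbered from 0, so i ranges over
   1, ..., k - 2 instead of 2, ..., k - 1. *)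
Definition SLO_ordering (k : nat) (v0 : G) (lt : rel G) : Prop :=
  strict_total_order lt /\
  [/\ forall u v, lt u v -> (height v0 u <= height v0 v)%N,
      forall u v u1 v1, is_parent v0 u u1 -> is_parent v0 v v1 ->
                 lt u v -> lt u1 v1,
      forall u v, lt u v ->
                 u \in boundary_vertices -> v \in boundary_vertices,
      forall (e : {set G}) (x : 'I_k -> G), e \in edges G ->
                 e = [set x i | i : 'I_k]%SET ->
                 (forall i j : 'I_k, (i < j)%N -> lt (x i) (x j)) ->
                 forall i j : 'I_k, (1 <= i)%N -> j = i.+1 :> nat ->
                 ~ exists v, [/\ v \notin e, lt (x i) v & lt v (x j)]
    & forall u v, u \in interior_vertices -> v \in interior_vertices ->
                 lt u v -> (deg u <= deg v)%N].

Definition SLO_supertree (k : nat) : Prop :=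
  supertree /\ exists (v0 : G) (lt : rel G), SLO_ordering k v0 lt.

Variable R : realType.
Implicit Type f : G -> R.

(* The double sum runs over ordered pairs, so it counts every unordered pair
   {u, v} twice; hence the factor 1/2. *)
Definition rayleigh (k : nat) f : R :=
  (2^-1 * \sum_u \sum_(v | adj u v) (k.-1)%:R^-1 * (f u - f v) ^+ 2)
  / \sum_v f v ^+ 2.

Definition dirichlet_admissible f : Prop :=
  (exists v, f v != 0) /\ (forall v, v \in boundary_vertices -> f v = 0).

(* The infimum is a minimum, see [first_eigenvalue_min]. *)
Definition first_eigenvalue (k : nat) : R :=
  inf [set rayleigh k f | f in [set f | dirichlet_admissible f]]%classic.

End Hypergraph.

Arguments first_eigenvalue G R k : clear implicits.

Definition isomorphic (G H : hypergraph) : Prop :=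
  exists f : G -> H, bijective f /\
    forall e : {set G}, (e \in edges G) = ((f @: e)%SET \in edges H).

Definition supertree_class (k d n n0 : nat) (G : hypergraph) : Prop :=
  [/\ supertree G /\ k_uniform G k,
      #|G| = n,
      #|interior_vertices G| = n0
    & forall v : G, v \in interior_vertices G -> (d <= deg v)%N].

Definition faber_krahn (R : realType) (k : nat) (C : hypergraph -> Prop)
    (G : hypergraph) : Prop :=
  C G /\ forall H : hypergraph, C H ->
    first_eigenvalue G R k <= first_eigenvalue H R k.

Lemma sum_continuous (R : realType) (T : topologicalType) (I : Type)
    (r : seq I) (P : pred I) (F : I -> T -> R) :
  (forall i, continuous (F i)) ->
  continuous (fun x => \sum_(i <- r | P i) F i x).
Proof.
move=> cF x; elim: r => [|i r IH].
  rewrite (_ : (fun _ => _) = cst 0); first exact: cst_continuous.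
  by apply/funext => y; rewrite big_nil.
rewrite (_ : (fun _ => _) =
    (fun y => (if P i then F i y else 0) + \sum_(j <- r | P j) F j y)).
  apply: cvgD; last exact: IH.
  by case: (P i); [exact: cF|exact: cvg_cst].
by apply/funext => y; rewrite big_cons; case: ifP => // _; rewrite add0r.
Qed.

Lemma first_eigenvalue_min (R : realType) (G : hypergraph) (k : nat) :
  interior_vertices G != finset.set0 ->
  exists f : G -> R, [/\ dirichlet_admissible f,
    first_eigenvalue G R k = rayleigh k f &
    forall g : G -> R, dirichlet_admissible g -> rayleigh k f <= rayleigh k g].
Proof.
move=> /set0Pn[w wI].
pose fn (v : 'rV[R]_#|G|) (x : G) := v ord0 (enum_rank x).
pose rv (g : G -> R) : 'rV[R]_#|G| := \row_i g (enum_val i).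
have rvK g : fn (rv g) = g.
  by apply/funext => x; rewrite /fn mxE enum_rankK.
have fnC x : continuous (fun v => fn v x) by move=> v; exact: coord_continuous.
have sqC (h : 'rV[R]_#|G| -> R) :
    continuous h -> continuous (fun v => h v ^+ 2).
  move=> ch v; have -> : (fun v => h v ^+ 2) = (fun v => h v * h v) by [].
  exact: (cvgM (ch v) (ch v)).
have mulC (a : R) (h : 'rV[R]_#|G| -> R) :
    continuous h -> continuous (fun v => a * h v).
  by move=> ch v; exact: (cvgM (cvg_cst a) (ch v)).
pose N (g : G -> R) := \sum_v g v ^+ 2.
pose Q (g : G -> R) :=
  2^-1 * \sum_u \sum_(v | adj u v) (k.-1)%:R^-1 * (g u - g v) ^+ 2.
have NC : continuous (fun v => N (fn v)).
  by apply: sum_continuous => x; apply: sqC; exact: fnC.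
have QC : continuous (fun v => Q (fn v)).
  apply: (mulC); apply: sum_continuous => x; apply: sum_continuous => y /=.
  apply: (@mulC _ (fun v => (fn v x - fn v y) ^+ 2)).
  apply: (@sqC (fun v => fn v x - fn v y)) => v.
  exact: (cvgB (fnC x v) (fnC y v)).
have NZ (a : R) g : N (fun x => a * g x) = a ^+ 2 * N g.
  by rewrite /N mulr_sumr; apply: eq_bigr => x _; rewrite exprMn.
have QZ (a : R) g : Q (fun x => a * g x) = a ^+ 2 * Q g.
  rewrite /Q mulrCA; congr (_ * _); rewrite mulr_sumr; apply: eq_bigr => x _.
  rewrite mulr_sumr; apply: eq_bigr => y _.
  by rewrite -mulrBr exprMn mulrCA.
have N0 g : dirichlet_admissible g -> 0 < N g.
  move=> [[x gx] _]; rewrite /N (bigD1 x) //= ltr_wpDr //.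
    by apply: sumr_ge0 => y _; exact: sqr_ge0.
  by rewrite lt_neqAle sqr_ge0 andbT eq_sym sqrf_eq0.
pose S : set 'rV[R]_#|G| := [set v | N (fn v) = 1 /\
  forall x, x \in boundary_vertices G -> fn v x = 0]%classic.
have SE g : dirichlet_admissible g ->
    S (rv (fun x => (Num.sqrt (N g))^-1 * g x)).
  move=> gD; rewrite /S /= rvK NZ; split.
    by rewrite exprVn sqr_sqrtr ?ltW ?N0 // mulVf // gt_eqF ?N0.
  by move=> x xb; case: gD => _ -> //; rewrite mulr0.
have SD v : S v -> dirichlet_admissible (fn v).
  move=> [Nv bv]; split=> //; apply: contrapT => /forallNP v0.
  move: Nv; rewrite /N big1 => [/esym/eqP|x _]; first by rewrite oner_eq0.
  by move: (v0 x) => /negP; rewrite negbK => /eqP ->; rewrite expr0n.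
have gw : dirichlet_admissible (fun x : G => (x == w)%:R : R).
  split; first by exists w; rewrite eqxx oner_eq0.
  move=> x xb; case: eqP => // xw; move: wI; rewrite -xw.
  by rewrite !inE in xb *; rewrite xb.
have Sclosed : closed S.
  rewrite (_ : S = ((fun v => N (fn v)) @^-1` [set x | x = 1] `&`
    \bigcap_(x in [set x | x \in boundary_vertices G])
      ((fun v => fn v x) @^-1` [set y | y = 0]))%classic) //.
  apply: closedI.
    by apply: preimage_closed => //; exact: closed_eq.
  apply: closed_bigI => x _.
  by apply: preimage_closed => //; exact: closed_eq.
have Scompact : compact S.
  apply: (@subclosed_compact _ S
    [set v : 'rV[R]_#|G| | forall i, `[(- 1 : R), 1]%classic (v ord0 i)]%classic) => //.
    apply: (@rV_compact R _ (fun=> `[(- 1 : R), 1]%classic)).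
    by move=> _; exact: segment_compact.
  move=> v [Nv _] i /=; rewrite in_itv /= -ler_norml.
  rewrite -(@expr_le1 _ 2) // real_normK ?num_real // -Nv /N.
  rewrite (bigD1 (enum_val i)) //= /fn enum_valK lerDl.
  by apply: sumr_ge0 => y _; exact: sqr_ge0.
have [c cS cmin] : exists2 c, c \in S & forall t, t \in S ->
    Q (fn c) <= Q (fn t).
  apply: compact_EVT_min => //; first by eexists; exact: SE gw.
  exact: continuous_subspaceT.
rewrite inE in cS; have cD := SD _ cS.
have rc : rayleigh k (fn c) = Q (fn c).
  by rewrite /rayleigh -/(Q _) -/(N _); case: cS => -> _; rewrite divr1.
have rmin (g : G -> R) : dirichlet_admissible g -> rayleigh k (fn c) <= rayleigh k g.
  move=> gD; have := cmin _ (mem_set (SE _ gD)); rewrite rvK QZ -rc.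
  by rewrite exprVn sqr_sqrtr ?(ltW (N0 _ gD)) // [_^-1 * _]mulrC.
exists (fn c); split=> //; apply/eqP; rewrite eq_le; apply/andP; split.
  apply: ge_inf; last by exists (fn c).
  by exists (rayleigh k (fn c)) => _ [g gD <-]; exact: rmin.
apply: lb_le_inf; first by exists (rayleigh k (fn c)), (fn c).
by move=> _ [g gD <-]; exact: rmin.
Qed.

(* Main.v *)
Require Import Defs.
From mathcomp Require Import all_boot all_order all_algebra reals.
From mathcomp Require Import boolp zify ring lra.

(** Root a supertree at a maximum of a nonnegative minimiser [f] of the Rayleigh
    quotient.  An edge whose vertex nearest to the root has value [p] and whose
    other [k - 1] vertices have sum [S] contributes [(k-1) p^2 - 2 p S - S^2] to
    [k - 1] times the energy, up to terms depending only on [f r] and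
    [sum f^2].  Hence, for prescribed values [s_0 >= s_1 >= ...], the energy is
    least when the children are cut into blocks of [k - 1] consecutive values,
    handed out in decreasing order to parents in decreasing order, each parent
    but the last interior one taking as few edges as the degree bound allows:
    this is a rearrangement inequality, proved by Abel summation.  The optimal
    arrangement is the breadth-first tree [bfs_tree], and every SLO-supertree
    with the required degrees is isomorphic to it.

    Conversely, in case of equality the sorted values form a Dirichlet
    eigenfunction of [bfs_tree].  Its eigenvalue equation forces tied interior
    vertices to have children with equal values, so that the ties of [f] on the
    original supertree can be broken compatibly with an SLO-ordering. *)

Set Implicit Arguments.
Unset Strict Implicit.
Unset Printing Implicit Defensive.

(** * Walks and rooted supertrees *)

(** The energy sees a supertree only through the top value and the child sum of each edge, so [G] is
    compared with [bfs_tree] in a single step and no intermediate tree is built. The obstacle is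
    that sorting the edges by top value and sorting them by child sum may disagree. The products p S
    are therefore treated in the first order and the squares S^2 in the second; only equality shows
    that the first order sorts the child sums as well. Rooting at a maximum makes f(r) equal to s_0,
    so that the root terms of the two trees cancel.

    The bound [n0 * D < m] comes from counting: each of the [n0] interior vertices is the top of at
    least [D] edges, and the root, which has no parent edge, of one more. That additional edge,
    numbered 0, breaks the pattern of [D] edges per vertex and needs separate care wherever ties are
    discussed. *)

Section Walks.
Variable G : hypergraph.
Implicit Types (u v w r : G) (e : {set G}) (p q : seq ({set G} * G)).

Lemma walk_cat u p q :
  is_walk u (p ++ q) = is_walk u p && is_walk (endpoint u p) q.
Proof. by elim: p u => [|[e v] p IH] u //=; rewrite IH -!andbA. Qed.

Lemma endpoint_cat u p q : endpoint u (p ++ q) = endpoint (endpoint u p) q.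
Proof. by rewrite /endpoint /unzip2 map_cat last_cat. Qed.

Lemma path_suffix u p x q :
  is_path u (p ++ x :: q) -> is_path x.2 q.
Proof.
rewrite /is_path walk_cat /= => /and3P[/andP[_]].
case: x => e x /= /and4P[_ _ _ ->].
rewrite /unzip1 /unzip2 !map_cat /= !cat_uniq /=.
by case/and5P=> _ _ _ -> -> /and4P[_ _ _ ->].
Qed.

(** The edges are controlled as well as the endpoint, because acyclicity is applied below to walks
    that avoid a given edge. *)
Lemma walk_path u p : is_walk u p ->
  exists q, [/\ is_path u q, endpoint u q = endpoint u p
              & {subset unzip1 q <= unzip1 p}].
Proof.
elim: p u => [|[e w] p IH] u /=; first by exists [::].
case/and4P=> eE ue we /IH[q [qP qe qs]].
have [uq|uq] := boolP (u \in w :: unzip2 q).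
  move: uq; rewrite inE => /predU1P[->|uq].
    by exists q; split=> // x /qs xp; rewrite inE xp orbT.
  have /mapP[[e' u'] uq' /= uE] := uq; subst u'.
  case/splitPr: uq' qP qe qs => q1 q2 qP qe qs.
  exists q2; split; first exact: (path_suffix qP).
    by rewrite -[RHS]qe /endpoint /unzip2 map_cat last_cat.
  move=> x xq; rewrite inE; apply/orP; right; apply: qs.
  by rewrite /unzip1 map_cat mem_cat /= inE xq !orbT.
(* If [e] is used again, jump from [u] along [e] straight to the vertex that follows this later
   use. *)
have [eq|eq] := boolP (e \in unzip1 q).
  have /mapP[[e' x] xq /= eE'] := eq; subst e'.
  case/splitPr: xq qP qe qs uq {eq} => q1 q2 qP qe qs uq.
  exists ((e, x) :: q2); split.
  - have := path_suffix qP; rewrite /is_path /= => /and3P[-> /andP[-> ->] _].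
    move: (qP); rewrite /is_path walk_cat /= => /and3P[/andP[_ /and4P[_ _ -> _]] _].
    rewrite /unzip1 map_cat cat_uniq => /and3P[_ _ /= ->].
    rewrite eE ue !andbT /=; apply: contra uq => uq.
    by rewrite /unzip2 map_cat !inE mem_cat /= uq !orbT.
  - by rewrite -[RHS]qe /endpoint /unzip2 map_cat last_cat.
  - move=> y; rewrite !inE => /predU1P[->|yq]; first by rewrite eqxx.
    by apply/orP; right; apply: qs; rewrite /unzip1 map_cat mem_cat /= inE yq !orbT.
exists ((e, w) :: q); split=> //.
  move: qP; rewrite /is_path /= => /and3P[-> -> ->].
  by rewrite eE ue we uq eq.
by move=> y; rewrite !inE => /predU1P[->|/qs ->]; rewrite ?eqxx ?orbT.
Qed.

(** Connection after deletion of the edge [e]. In a supertree this separates the vertices of [e] and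
    tells which of them lies on the side of the root. *)
Definition avoids e u v :=
  exists p, [/\ is_walk u p, endpoint u p = v & e \notin unzip1 p].

Lemma avoids_refl e u : avoids e u u.
Proof. by exists [::]. Qed.

Lemma avoids_trans e v u w : avoids e u v -> avoids e v w -> avoids e u w.
Proof.
move=> [p [pw pe pn]] [q [qw qe qn]]; exists (p ++ q).
by rewrite walk_cat endpoint_cat pe pw qw /unzip1 map_cat mem_cat negb_or pn.
Qed.

Lemma avoids_step e e' u v : e' \in edges G -> u \in e' -> v \in e' ->
  e' != e -> avoids e u v.
Proof.
move=> eE ue ve ne; exists [:: (e', v)].
by rewrite /= eE ue ve inE eq_sym.
Qed.

Lemma avoids_sym e u v : avoids e u v -> avoids e v u.
Proof.
case=> p []; elim: p u => [|[e' w] p IH] u /=; first by move=> _ <- _; apply: avoids_refl.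
case/and4P=> eE ue we pw pe; rewrite inE negb_or => /andP[ne pn].
apply: (avoids_trans (IH _ pw pe pn)).
by apply: avoids_step eE we ue _; rewrite eq_sym.
Qed.

(** The witness [t] is where the walk arrives by its last use of [e]. *)
Lemma avoids_enter e u p : is_walk u p ->
  avoids e u (endpoint u p) \/ exists2 t, t \in e & avoids e t (endpoint u p).
Proof.
elim: p u => [|[e' w] p IH] u /=; first by left; apply: avoids_refl.
case/and4P=> eE ue we /IH[aw|]; last by right.
have [ee|ne] := eqVneq e' e; first by right; exists w; rewrite -?ee // ee.
by left; apply: avoids_trans aw; apply: avoids_step ne.
Qed.

Hypothesis acG : hacyclic G.

(** A path avoiding [e] would be closed by [e] to a cycle; it is non-empty when [u] and [v] differ,
    so the cycle has length at least two. *)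
Lemma acyclic_avoids e u v : e \in edges G -> u \in e -> v \in e ->
  avoids e u v -> u = v.
Proof.
move=> eE ue ve [p [pw pe pn]]; apply/eqP/negPn/negP => uv.
have [q [/and3P[qw qu qn] qe qs]] := walk_path pw.
have := acG u (rcons q (e, u)); rewrite /is_cycle.
rewrite -cats1 walk_cat endpoint_cat qw qe pe /= eE ve ue /=.
rewrite /endpoint eqxx /= /unzip1 /unzip2 !map_cat !cat_uniq /= !orbF !andbT.
have -> : (1 < size (q ++ [:: (e, u)])).
  rewrite size_cat addn1 ltnS lt0n size_eq0; apply: contraNneq uv => q0.
  by rewrite -pe -qe q0.
move: qu qn => /= /andP[-> ->] -> /=.
by rewrite (contra (qs e)).
Qed.

End Walks.

Section Root.
Variable G : hypergraph.
Implicit Types (u v w r : G) (e : {set G}) (p q : seq ({set G} * G)).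
Hypothesis stG : supertree G.
Variable r : G.
Let acG : hacyclic G := stG.2.

(** The path has to use [e]. If it did so later, its initial part would join [v] to a vertex of [e]
    while avoiding [e]; by acyclicity that vertex is [v], which a path does not revisit. *)
Lemma path_first_edge v e p : e \in edges G -> v \in e -> ~ avoids e v r ->
  is_path v p -> endpoint v p = r -> exists w q, p = (e, w) :: q.
Proof.
move=> eE ve nav /and3P[pw pv pe] pr.
have [ep|ep] := boolP (e \in unzip1 p); last by case: nav; exists p.
have /mapP[[e' y] yp /= eE'] := ep; subst e'.
case/splitPr: yp pw pv pe pr {ep} => p1 p2; case: p1 => [|[e1 w] p1] /=.
  by exists y, p2.
set P := (e1, w) :: p1 => /and4P[e1E ve1 we1].
rewrite walk_cat => /andP[p1w /= /and4P[_ xe _ _]].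
move=> /andP[vn _] /andP[e1n pe] pr.
have: avoids e v (endpoint w p1).
  exists P; rewrite /= e1E ve1 we1 p1w; split=> //=.
  rewrite /unzip1 map_cat cat_uniq /= negb_or in pe e1n *.
  case/and3P: pe => _ /andP[en _] _; rewrite inE negb_or en andbT.
  by apply: contra e1n => /eqP<-; rewrite mem_cat inE eqxx orbT.
move/(acyclic_avoids acG eE ve xe) => vE; case/negP: vn; rewrite [in X in X \in _]vE.
have : endpoint w p1 \in w :: unzip2 p1 by exact: mem_last.
rewrite /unzip2 map_cat !inE mem_cat => /predU1P[->|->]; rewrite ?eqxx ?orbT //.
Qed.

Lemma path_step v e w p : is_path v ((e, w) :: p) -> endpoint w p = r ->
  [/\ e \in edges G, v \in e, w \in e & v != w] /\
  (~ avoids e v r /\ avoids e w r).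
Proof.
case/and3P=> /= /and4P[eE ve we pw] /andP[vn _] /andP[en _] pr.
have vw : v != w by apply: contra vn => /eqP->; rewrite inE eqxx.
have aw : avoids e w r by exists p.
split; split=> // av; case/eqP: vw; apply: (acyclic_avoids acG eE ve we).
exact: (avoids_trans av (avoids_sym aw)).
Qed.

(** The first edge of a path to [r] is forced, and so is the next vertex, the only one of that edge
    reaching [r] without it. Hence [dist] can be read off any path to the root. *)
Lemma paths_same_size v p q : is_path v p -> is_path v q ->
  endpoint v p = r -> endpoint v q = r -> size p = size q.
Proof.
have nil u s : is_path u s -> endpoint u s = u -> s = [::].
  case: s => // [[e w] s] /and3P[_ /= /andP[un _] _] ue; case/negP: un.
  by rewrite -[X in X \in _]ue /endpoint /=; exact: mem_last.
elim: p v q => [|[e w] p IH] v q pP qP pr qr.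
  by rewrite (nil _ _ qP) // qr.
have [[eE ve we vw] [nav aw]] := path_step pP pr.
have [w' [q' qE]] := path_first_edge eE ve nav qP qr; subst q.
have [[_ _ we' _] [_ aw']] := path_step qP qr.
have ww : w = w'.
  by apply: (acyclic_avoids acG eE we we') (avoids_trans aw (avoids_sym aw')).
subst w'; congr _.+1; apply: (IH w) => //.
- exact: (@path_suffix _ v [::] _ _ pP).
- exact: (@path_suffix _ v [::] _ _ qP).
Qed.

Lemma height_path v p : is_path v p -> endpoint v p = r ->
  height r v = size p.
Proof.
move=> pP pr; rewrite /height /dist.
set P := (fun m : nat => _); set N := #|G|.
have pN : size p < N.
  case/and3P: pP => _ pu _; have := card_uniqP pu; rewrite /= size_map => <-.
  exact: max_card.
have Pp : P (size p).
  by apply/existsP; exists (in_tuple p); rewrite pP pr eqxx.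
have hP : has P (iota 0 N) by apply/hasP; exists (size p); rewrite ?mem_iota.
have := nth_find 0 hP; rewrite nth_iota; last by rewrite -[X in _ < X](size_iota 0) -has_find.
rewrite add0n => /existsP[q /andP[qP /eqP qr]].
by rewrite (paths_same_size pP qP pr qr) size_tuple.
Qed.

(* [top e] is the vertex of [e] that reaches [r] without using [e]; [up v] is
   the first edge of every path from [v] to [r]. *)
Lemma rooted_supertree : finset.set0 \notin edges G ->
  exists (top : {set G} -> G) (up : G -> {set G}),
  [/\ forall e, e \in edges G -> top e \in e,
      forall v, v != r -> [/\ up v \in edges G, v \in up v & v != top (up v)],
      forall e v, e \in edges G -> v \in e -> v != top e -> v != r /\ up v = e,
      forall v, v != r -> height r v = (height r (top (up v))).+1
    & height r r = 0].
Proof.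
move=> ne0.
have topP e : exists t, e \in edges G -> e != finset.set0 -> t \in e /\ avoids e t r.
  have [->|[v ve]] := set_0Vmem e; first by exists r; rewrite eqxx.
  have [p [/and3P[pw _ _] pr]] := stG.1 v r.
  have [av|[t te ta]] := avoids_enter e pw.
    by rewrite pr in av; exists v.
  by rewrite pr in ta; exists t.
have {topP} [top topP] := choice topP.
have topE e v : e \in edges G -> v \in e -> top e \in e /\ avoids e (top e) r.
  by move=> eE ve; apply: topP => //; apply/set0Pn; exists v.
have topU e v : e \in edges G -> v \in e -> avoids e v r -> v = top e.
  move=> eE ve av; have [te ta] := topE e v eE ve.
  apply: (acyclic_avoids acG eE ve te).
  exact: avoids_trans av (avoids_sym ta).
have upP v : exists e, v != r ->
    [/\ e \in edges G, v \in e, v != top e & height r v = (height r (top e)).+1].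
  have [vr|vr] := eqVneq v r; first by exists finset.set0.
  have [p [pP pr]] := stG.1 v r.
  case: p pP pr => [|[e w] p] pP pr; first by rewrite -pr eqxx in vr.
  have [[eE ve we vw] [nav aw]] := path_step pP pr.
  exists e => _; rewrite -(topU e w) //; split=> //.
  by rewrite (height_path pP pr) (height_path (@path_suffix _ v [::] _ _ pP)).
have {upP} [up upP] := choice upP.
exists top, up; split.
- move=> e eE; have [e0|[v ve]] := set_0Vmem e; last by have [] := topE e v eE ve.
  by rewrite e0 (negPf ne0) in eE.
- by move=> v /upP[].
- move=> e v eE ve vt.
  have nav : ~ avoids e v r by move/(topU _ _ eE ve)/eqP; rewrite (negPf vt).
  have vr : v != r by apply/eqP => vr; apply: nav; rewrite vr; apply: avoids_refl.
  split=> //; have [uE vu vtu _] := upP v vr.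
  have nau : ~ avoids (up v) v r by move/(topU _ _ uE vu)/eqP; rewrite (negPf vtu).
  have [p [pP pr]] := stG.1 v r.
  have [w [q pE]] := path_first_edge eE ve nav pP pr.
  by have [w' [q' pE']] := path_first_edge uE vu nau pP pr; move: pE'; rewrite pE => -[].
- by move=> v /upP[].
- by apply: (@height_path r [::]).
Qed.

End Root.

(* [E] enumerates the edges, [tp j] is the vertex of [E j] nearest to the root
   [r] and [ix v] the index of the edge leading from [v] towards [r] (no meaning
   for [v = r]); [hgt] is any function decreasing towards the root. *)
Record rooting (G : hypergraph) (r : G) (m : nat) (E : nat -> {set G})
    (tp : nat -> G) (ix : G -> nat) (hgt : G -> nat) : Prop := Rooting {
  rt_edges : forall e, e \in edges G <-> exists2 j, j < m & e = E j;
  rt_inj : forall i j, i < m -> j < m -> E i = E j -> i = j;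
  rt_mem : forall j v, j < m ->
    (v \in E j) = (v == tp j) || (v != r) && (ix v == j);
  rt_ix : forall v, v != r -> ix v < m;
  rt_hgt : forall v, v != r -> hgt (tp (ix v)) < hgt v }.

(** Every enumeration of the edges is allowed because the comparison uses two of them, sorted by
    different keys. *)
Lemma supertree_rooting (G : hypergraph) (k : nat) (r : G) :
  supertree G -> k_uniform G k -> 1 < k ->
  exists (top : {set G} -> G) (up : G -> {set G}),
  [/\ forall es, perm_eq es (enum (edges G)) ->
        rooting r (size es) (nth finset.set0 es)
          (fun j => top (nth finset.set0 es j)) (fun v => index (up v) es)
          (height r),
      forall v, v != r -> up v \in edges G /\ v \in up v,
      forall e v, e \in edges G -> v \in e -> v != top e -> v != r /\ up v = e,
      forall v, v != r -> height r v = (height r (top (up v))).+1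
    & height r r = 0].
Proof.
move=> stG kG k2.
have ne0 : finset.set0 \notin edges G.
  by apply/negP => /kG; rewrite cards0 => k0; rewrite -k0 in k2.
have [top [up [topE upE chE hE h0]]] := rooted_supertree stG r ne0.
exists top, up; split=> //; last by move=> v /upE[].
move=> es pes.
have esE e : (e \in es) = (e \in edges G) by rewrite (perm_mem pes) mem_enum.
have ues : uniq es by rewrite (perm_uniq pes) enum_uniq.
split.
- move=> e; rewrite -esE; split=> [ein|[j jm ->]]; last exact: mem_nth.
  by exists (index e es); rewrite ?index_mem ?nth_index.
- by move=> i j im jm /eqP; rewrite nth_uniq // => /eqP.
- move=> j v jm; have ejE : nth finset.set0 es j \in edges G by rewrite -esE mem_nth.
  apply/idP/idP => [vj|/predU1P[->|/andP[vr /eqP vj]]].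
  + have [//|vt] := eqVneq v _; have [-> ->] := chE _ _ ejE vj vt.
    by rewrite index_uniq // eqxx.
  + exact: topE.
  + by have [uE vu _] := upE v vr; rewrite -vj nth_index ?esE.
- by move=> v /upE[uE _ _]; rewrite index_mem esE.
- by move=> v vr; have [uE _ _] := upE v vr; rewrite nth_index ?esE // [ltnRHS]hE.
Qed.

Section Rooting.
Variables (G : hypergraph) (r : G) (m : nat) (E : nat -> {set G}).
Variables (tp : nat -> G) (ix hgt : G -> nat).
Hypothesis rt : rooting r m E tp ix hgt.
Implicit Types (u v : G) (e : {set G}).

Lemma rt_edge j : j < m -> E j \in edges G.
Proof. by move=> jm; apply/(rt_edges rt); exists j. Qed.

Lemma rt_top j : j < m -> tp j \in E j.
Proof. by move=> jm; rewrite (rt_mem rt) // eqxx. Qed.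

Lemma rt_child v : v != r -> v \in E (ix v).
Proof. by move=> vr; rewrite (rt_mem rt) ?(rt_ix rt) // vr eqxx orbT. Qed.

Lemma rt_neq_top v : v != r -> v != tp (ix v).
Proof. by move=> vr; apply: contraTneq (rt_hgt rt vr) => <-; rewrite ltnn. Qed.

Lemma rt_top_child j : ((tp j != r) && (ix (tp j) == j)) = false.
Proof.
apply/negP => /andP[vr /eqP vj]; move: (rt_neq_top vr).
by rewrite vj eqxx.
Qed.

Lemma rt_adjE u v : u != v -> adj u v ->
  exists2 j, j < m & [&& u \in E j, v \in E j & (u == tp j) || (v == tp j) || (ix u == ix v)].
Proof.
move=> uv /andP[_ /existsP[e /andP[/(rt_edges rt)[j jm ->] /andP[uj vj]]]].
exists j => //; rewrite uj vj /=; move: uj vj; rewrite !(rt_mem rt) //.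
case/predU1P=> [->|/andP[_ /eqP->]]; first by rewrite eqxx.
case/predU1P=> [->|/andP[_ /eqP->]]; first by rewrite eqxx orbT.
by rewrite eqxx orbT.
Qed.

(** Two vertices shared by different edges would each be a child in one edge with the other as its
    top, and [hgt] would have to decrease both ways. *)
Lemma rt_edge_unique u v i j : i < m -> j < m -> u != v ->
  u \in E i -> v \in E i -> u \in E j -> v \in E j -> i = j.
Proof.
move=> im jm uv; rewrite !(rt_mem rt) //.
case/predU1P => [ui|/andP[ur /eqP <-]].
  rewrite ui eq_sym in uv; rewrite (negPf uv) /= => /andP[vr /eqP vi].
  case/predU1P=> [tij|/andP[ur /eqP uj]]; last first.
    case/predU1P=> [vj|/andP[_ /eqP <-] //].
    have := rt_hgt rt vr; have := rt_hgt rt ur.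
    by rewrite vi uj -vj -ui; lia.
  by case/predU1P=> [vj|/andP[_ /eqP <-] //]; rewrite vj -ui tij eqxx in uv.
case/predU1P => [vi|/andP[vr /eqP vi]].
  case/predU1P=> [uj|/andP[_ /eqP //]].
  rewrite -uj; case/predU1P=> [/eqP|/andP[vr /eqP vj]]; first by rewrite eq_sym (negPf uv).
  have := rt_hgt rt vr; have := rt_hgt rt ur.
  by rewrite -vi vj -uj; lia.
case/predU1P=> [uj|/andP[_ /eqP //]]; case/predU1P=> [vj|/andP[_ /eqP <-] //].
by rewrite uj vj eqxx in uv.
Qed.

Section Big.
Variables (T : Type) (idx : T) (op : Monoid.com_law idx).

Lemma rt_big (g : G -> T) :
  \big[op/idx]_v g v = op (g r)
    (\big[op/idx]_(j < m) \big[op/idx]_(v | (v != r) && (ix v == j)) g v).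
Proof.
rewrite (bigD1 r) //=; congr (op _ _).
(* [inord] needs a non-empty index type; without edges the root is the only vertex. *)
case: m rt => [|m' rt'].
  move=> rt0; rewrite big_ord0 big_pred0 // => v.
  by apply/negP => /negP vr; have := rt_ix rt0 vr.
rewrite (partition_big (fun v => inord (ix v) : 'I_m'.+1) xpredT) //=.
apply: eq_bigr => j _; apply: eq_bigl => v.
have [//|vr /=] := eqVneq v r.
by rewrite -(inj_eq val_inj) /= inordK // (rt_ix rt').
Qed.

Lemma rt_big_edge j (g : G -> T) : j < m ->
  \big[op/idx]_(v in E j) g v = op (g (tp j))
    (\big[op/idx]_(v | (v != r) && (ix v == j)) g v).
Proof.
move=> jm; rewrite (bigD1 (tp j)) ?rt_top //=; congr (op _ _).
apply: eq_bigl => v; rewrite (rt_mem rt) //.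
have [->|_] := eqVneq v (tp j); first by rewrite rt_top_child.
by rewrite andbT.
Qed.

End Big.

Lemma rt_enum_edges (P : pred {set G}) :
  #|[set e in edges G | P e]| = \sum_(j < m) P (E j).
Proof.
have -> : [set e in edges G | P e]%SET = [set E j | j : 'I_m in [set j : 'I_m | P (E j)]]%SET.
  apply/setP => e; rewrite inE; apply/andP/imsetP.
    by move=> [/(rt_edges rt)[j jm ->] pj]; exists (Ordinal jm); rewrite ?inE.
  by case=> j; rewrite inE => pj ->; rewrite rt_edge.
rewrite card_in_imset -?sum1dep_card ?big_mkcond; last first.
  by move=> i j _ _ /(rt_inj rt (ltn_ord i) (ltn_ord j))/val_inj.
by apply: eq_bigr => j _; case: (P _).
Qed.

Lemma rt_deg v : deg v = (\sum_(j < m) (tp j == v)) + (v != r).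
Proof.
rewrite /deg rt_enum_edges.
have -> : (v != r : nat) = \sum_(j < m) (v != r) && (ix v == j).
  have [|vr] := eqVneq v r; first by rewrite big1.
  rewrite (bigD1 (Ordinal (rt_ix rt vr))) //= eqxx big1 //= => j.
  by rewrite -val_eqE /= eq_sym => /negPf->.
rewrite -big_split /=; apply: eq_bigr => j _.
rewrite (rt_mem rt) // [tp j == v]eq_sym.
have [->|_ /=] := eqVneq v (tp j); first by rewrite rt_top_child.
by [].
Qed.

Section Uniform.
Variable K : nat.
Hypothesis uG : k_uniform G K.+1.

Lemma rt_card_children j : j < m -> \sum_(v | (v != r) && (ix v == j)) 1 = K.
Proof.
move=> jm; have := uG (rt_edge jm); rewrite -sum1_card (rt_big_edge _ _ jm).
by move=> [].
Qed.

Lemma rt_card : #|G| = (m * K).+1.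
Proof.
rewrite -sum1_card (rt_big _ (fun=> 1)) (eq_bigr (fun=> K)).
  by rewrite sum_nat_const card_ord.
by move=> j _; rewrite rt_card_children.
Qed.

End Uniform.

End Rooting.

(** * Supertrees from rootings *)

Section RootingSupertree.
Variables (G : hypergraph) (r : G) (m : nat) (E : nat -> {set G}).
Variables (tp : nat -> G) (ix hgt : G -> nat).
Hypothesis rt : rooting r m E tp ix hgt.
Implicit Types (u v : G) (e : {set G}).

Lemma rooting_connected : finset.set0 \notin edges G -> hconnected G.
Proof.
(* The empty set is not an edge, so avoiding it means plain reachability. *)
move=> ne0; have toroot v : avoids finset.set0 v r.
  have [n] := ubnP (hgt v); elim: n v => // n IH v; rewrite ltnS => vn.
  have [->|vr] := eqVneq v r; first exact: avoids_refl.
  have jm := rt_ix rt vr; apply: (@avoids_trans _ _ (tp (ix v))); last first.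
    by apply: IH; apply: leq_trans (rt_hgt rt vr) vn.
  apply: (avoids_step (rt_edge rt jm) (rt_child rt vr) (rt_top rt jm)).
  by apply: contraNneq ne0 => <-; rewrite (rt_edge rt).
move=> u v; have [p [pw pe _]] := avoids_trans (toroot u) (avoids_sym (toroot v)).
by have [q [qP qe _]] := walk_path pw; exists q; rewrite qe.
Qed.

Lemma rooting_two_edges x e e' : e \in edges G -> e' \in edges G -> e != e' ->
  x \in e -> x \in e' ->
  (forall y, y \in e -> y != x -> hgt x < hgt y) \/
  (forall y, y \in e' -> y != x -> hgt x < hgt y).
Proof.
move=> /(rt_edges rt)[i im ->] /(rt_edges rt)[j jm ->] ne xi xj.
have ch l y : l < m -> x = tp l -> y \in E l -> y != x -> hgt x < hgt y.
  move=> lm xl; rewrite (rt_mem rt) // -xl => /orP[/eqP->|/andP[yr /eqP yl _]].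
    by rewrite eqxx.
  by rewrite xl -yl (rt_hgt rt).
move: xi xj; rewrite !(rt_mem rt) //.
case/predU1P=> [xi|/andP[_ /eqP xi]]; first by left=> y; apply: ch.
case/predU1P=> [xj|/andP[_ /eqP xj]]; first by right=> y; apply: ch.
by rewrite -xi xj eqxx in ne.
Qed.

(* A vertex of a cycle maximising [hgt] lies on two edges of the cycle and is the
   top of one of them, whose other vertices have larger [hgt]. *)
Lemma rooting_acyclic : hacyclic G.
Proof.
move=> u p; apply/negP => /and5P[p1 pw /eqP pu pv pe].
have uv : u \in unzip2 p.
  case: p p1 pu {pw pv pe} => // [[e w] p] _ <-.
  by rewrite /endpoint /=; exact: mem_last.
pose x := [arg max_(x > u | x \in unzip2 p) hgt x].
have [xv xmax] : x \in unzip2 p /\ forall y, y \in unzip2 p -> hgt y <= hgt x.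
  by rewrite /x; case: arg_maxnP.
suff [e [e' [y [y' [[eE e'E ee' xe xe'] [ye ye' [yx y'x] [yp y'p]]]]]]] :
   exists e e' y y', [/\ e \in edges G, e' \in edges G, e != e', x \in e & x \in e'] /\
      [/\ y \in e, y' \in e', y != x /\ y' != x & y \in unzip2 p /\ y' \in unzip2 p].
  case: (rooting_two_edges eE e'E ee' xe xe') => h.
    by have := h y ye yx; rewrite ltnNge xmax.
  by have := h y' ye' y'x; rewrite ltnNge xmax.
move: x xv {xmax} => x /mapP[[e z] xp /= zx]; subst z.
case/splitPr: xp p1 pw pu pv pe uv => q1 q2.
rewrite walk_cat /unzip1 /unzip2 !map_cat /= => p1 /andP[q1w /and4P[eE ye xe q2w]] pu.
rewrite (cat_uniq (map snd q1)) (cat_uniq (map fst q1)) /= negb_or.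
move=> /and4P[u1 /andP[x1 _] x2 u2] /and4P[w1].
rewrite negb_or => /andP[e1 _] e2 w2 uv.
have [yx yp] : endpoint u q1 != x /\ endpoint u q1 \in map snd q1 ++ x :: map snd q2.
  case: q1 p1 q1w pu u1 x1 w1 e1 ye uv => [|[e1 w1] q1] /=.
    move=> p1 _ pu _ _ _ _ _ uv; rewrite /endpoint /=; split=> //.
    case: q2 p1 pu x2 {q2w u2 e2 w2 uv} => // [[e2 w2] q2] _ <- x2.
    by apply: contraNneq x2 => <- /=; rewrite /endpoint /=; exact: mem_last.
  move=> _ _ _ _ x1 _ _ _ _; rewrite /endpoint /=.
  have ml := mem_last w1 (unzip2 q1); split; first by apply: contraNneq x1 => <-.
  by rewrite -cat_cons mem_cat ml.
(* The second edge at [x] is the next one of the walk or, if [x] closes the cycle, the first one. *)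
case: q2 p1 q2w pu x2 u2 e2 w2 uv yp => [|[e2 w2] q2] /=.
  move=> p1 _ pu _ _ _ _ uv yp.
  have xu : x = u by rewrite -pu endpoint_cat.
  case: q1 p1 q1w u1 x1 w1 e1 yx ye pu uv yp => // [[e1 w1] q1] p1 /=.
  case/and4P=> e1E ue1 we1 _ _ x1 _ e1n yx ye pu uv yp.
  exists e, e1, (endpoint w1 q1), w1; do !split=> //.
  - by apply: contraNneq e1n => ->; rewrite inE eqxx.
  - by rewrite xu.
  - by apply: contraNneq x1 => <-; rewrite inE eqxx.
  - by rewrite inE eqxx.
case=> // _ /and4P[e2E xe2 we2 _] _; rewrite !inE !negb_or => /andP[xw2 _] _ /andP[ee2 _] _ uv yp.
exists e, e2, (endpoint u q1), w2; do !split=> //; first by rewrite eq_sym.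
by rewrite mem_cat !inE eqxx !orbT.
Qed.

Lemma rooting_supertree : finset.set0 \notin edges G -> supertree G.
Proof. by move=> ne0; split; [exact: rooting_connected|exact: rooting_acyclic]. Qed.

End RootingSupertree.

Section BigNat.
Variables (V : Type) (idx : V) (op : Monoid.com_law idx).

Lemma big_nat_interval (n a b : nat) (P : pred nat) (h : nat -> V) : b <= n ->
  (forall i, i < n -> P i = (a <= i < b)) ->
  \big[op/idx]_(i < n | P i) h i = \big[op/idx]_(a <= i < b) h i.
Proof.
move=> bn PE; rewrite -(big_mkord P h) (big_nat_widenl a 0) // (big_nat_widen 0 b n) //=.
by apply: congr_big_nat => // i /andP[_ /PE].
Qed.

End BigNat.

Lemma pred_divn_eq K i j : 0 < K -> 0 < i ->
  (i.-1 %/ K == j) = ((j * K).+1 <= i < (j.+1 * K).+1).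
Proof.
move=> K0; case: i => //= i _.
rewrite eqn_leq andbC leq_divRL // !ltnS; congr (_ && _).
by rewrite -[LHS]ltnS ltn_divLR // ltnS.
Qed.

(** * The breadth-first tree *)

Section BreadthFirstTree.
Variables (K D m n0 : nat).

(* The vertices are numbered breadth first: edge [j] has the children [j K + 1],
   ..., [(j + 1) K], with [K = k - 1], and, with [D = d - 1], vertex [i] is the top
   of [D] edges.  The truncated [j.-1] gives edge 0 to the root, which has no
   parent edge, and the minimum gives all remaining edges to the last of the
   [n0] interior vertices. *)
Definition bfs_parent (j : nat) : nat := minn n0.-1 (j.-1 %/ D).

Definition bfs_edge (j : nat) : {set 'I_(m * K).+1} :=
  [set i : 'I_(m * K).+1 | (i == bfs_parent j :> nat) || (i != ord0) && (i.-1 %/ K == j)]%SET.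

Definition bfs_tree : hypergraph := Hypergraph [set bfs_edge j | j : 'I_m]%SET.

(* Apart from edge 0, the edges with top [i] are those with index in
   [[bfs_lo i, bfs_hi i)]. *)
Definition bfs_lo (i : nat) : nat := (i * D).+1.
Definition bfs_hi (i : nat) : nat := if i.+1 == n0 then m else (i.+1 * D).+1.

Hypotheses (K0 : 0 < K) (D0 : 0 < D) (n00 : 0 < n0) (n0m : n0 * D < m).

Lemma bfs_parent_mono i j : i <= j -> bfs_parent i <= bfs_parent j.
Proof.
move=> ij; rewrite /bfs_parent leq_min geq_minl /= (leq_trans (geq_minr _ _)) //.
by apply: leq_div2r; case: i j ij => [|i] [|j].
Qed.

Lemma bfs_parent_lt j : bfs_parent j < n0.
Proof. by clear -n00; rewrite /bfs_parent; lia. Qed.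

Lemma bfs_parent_le j : bfs_parent j <= j.
Proof.
by rewrite /bfs_parent (leq_trans (geq_minr _ _)) // (leq_trans (leq_div _ _)) ?leq_pred.
Qed.

Lemma bfs_parent0 : bfs_parent 0 = 0.
Proof. by rewrite /bfs_parent div0n minn0. Qed.

Lemma interior_count_le : n0 <= m * K.
Proof. by clear -K0 D0 n0m; nia. Qed.

Lemma bfs_parentE i j : i < n0 -> 0 < j -> j < m -> (bfs_parent j == i) = (bfs_lo i <= j < bfs_hi i).
Proof.
move=> i0 j0 jm; rewrite /bfs_lo /bfs_hi.
case: (i.+1 =P n0) => [i1|i1].
  rewrite jm andbT /bfs_parent -i1 /=.
  have -> : (i * D < j) = (i <= j.-1 %/ D).
    by rewrite leq_divRL //; case: j j0 {jm}.
  by lia.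
rewrite -pred_divn_eq // /bfs_parent.
by apply/eqP/eqP; lia.
Qed.

Lemma bfs_lo_hi i : i < n0 -> bfs_lo i <= bfs_hi i <= m.
Proof. by move=> i0; rewrite /bfs_lo /bfs_hi; case: eqP => i1; nia. Qed.

Lemma big_bfs_parent (V : Type) (idx : V) (op : Monoid.com_law idx) (h : nat -> V) i :
  i < n0 ->
  \big[op/idx]_(j < m | bfs_parent j == i) h j =
  op (if i == 0 then h 0 else idx) (\big[op/idx]_(bfs_lo i <= j < bfs_hi i) h j).
Proof.
move=> i0; have m0 : 0 < m by lia.
rewrite -(big_mkord (fun j => bfs_parent j == i) h) big_ltn_cond // bfs_parent0.
have -> : \big[op/idx]_(1 <= j < m | bfs_parent j == i) h j =
          \big[op/idx]_(bfs_lo i <= j < bfs_hi i) h j.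
  have /andP[lc cm] := bfs_lo_hi i0.
  rewrite [RHS](big_nat_widenl (bfs_lo i) 1) // [RHS](big_nat_widen 1 (bfs_hi i) m) //.
  apply: congr_big_nat => // j /andP[j1 jm] /=.
  by rewrite bfs_parentE.
by rewrite eq_sym; case: eqP; rewrite ?Monoid.mul1m.
Qed.

Lemma big_bfs_child (V : Type) (idx : V) (op : Monoid.com_law idx) (h : nat -> V) j :
  j < m ->
  \big[op/idx]_(i : 'I_(m * K).+1 | (i != ord0) && (i.-1 %/ K == j)) h i =
  \big[op/idx]_(l < K) h (j * K + l).+1.
Proof.
move=> jm; rewrite (big_nat_interval _ _ (a := (j * K).+1) (b := (j.+1 * K).+1)
   (P := fun i => (i != 0) && (i.-1 %/ K == j))).
- rewrite -{1}[(j * K).+1]addn0 addnC big_addn big_mkord.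
  have -> : (j.+1 * K).+1 - (j * K).+1 = K by nia.
  by apply: eq_bigr => l _; rewrite addnS addnC.
- by rewrite ltnS leq_mul2r jm orbT.
- by case=> [|i] // _; rewrite pred_divn_eq.
Qed.

Lemma bfs_tree_rooting : rooting (G := bfs_tree) ord0 m bfs_edge
  (fun j => inord (bfs_parent j)) (fun i => i.-1 %/ K) (fun i => i).
Proof.
have pm j : j < m -> bfs_parent j < (m * K).+1.
  by move=> jm; have := bfs_parent_le j; nia.
split=> /=.
- move=> e; split=> [/imsetP[j _ ->]|[j jm ->]]; first by exists j.
  by apply/imsetP; exists (Ordinal jm).
- move=> i j im jm ij.
  (* The first child of edge [a] is either a child of edge [b] or its top. By [bfs_parent_le] the
     second case cannot hold in both directions. *)
  have ch a b : a < m -> b < m -> bfs_edge a = bfs_edge b -> a = b \/ bfs_parent b = (a * K).+1.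
    move=> am bm ab; have a1 : (a * K).+1 < (m * K).+1 by nia.
    have : Ordinal a1 \in bfs_edge a by rewrite inE /= mulnK // eqxx orbT.
    rewrite ab inE /= mulnK // => /predU1P[->|/eqP->]; by [right|left].
  have [//|ij1] := ch i j im jm ij; have [//|ij2] := ch j i jm im (esym ij).
  by have := bfs_parent_le i; have := bfs_parent_le j; nia.
- by move=> j v jm; rewrite inE -[v == inord _](inj_eq (@ord_inj _)) inordK // pm.
- move=> v v0; rewrite ltn_divLR //; have := ltn_ord v.
  by move: v0; rewrite -(inj_eq (@ord_inj _)) /=; lia.
- move=> v v0; have vm : v.-1 %/ K < m.
    rewrite ltn_divLR //; have := ltn_ord v.
    by move: v0; rewrite -(inj_eq (@ord_inj _)) /=; lia.
  rewrite inordK ?pm //; apply: leq_ltn_trans (bfs_parent_le _) _.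
  apply: leq_ltn_trans (leq_div _ _) _.
  by move: v0; rewrite -(inj_eq (@ord_inj _)) /=; lia.
Qed.

Lemma bfs_tree_uniform : k_uniform bfs_tree K.+1.
Proof.
move=> e /(rt_edges bfs_tree_rooting)[j jm ->].
rewrite -sum1_card (rt_big_edge bfs_tree_rooting _ _ jm).
by rewrite (big_bfs_child _ (fun=> 1) jm) sum1_card card_ord.
Qed.

Lemma bfs_tree_supertree : supertree bfs_tree.
Proof.
apply: (rooting_supertree bfs_tree_rooting).
by apply/negP => /bfs_tree_uniform; rewrite cards0.
Qed.

(** The added one is the parent edge or, for the root, edge 0, which the interval leaves out. *)
Lemma bfs_tree_deg (i : bfs_tree) :
  deg i = (if i < n0 then bfs_hi i - bfs_lo i else 0).+1.
Proof.
rewrite (rt_deg bfs_tree_rooting).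
have pE (j : 'I_m) : (inord (bfs_parent j) == i :> bfs_tree) = (bfs_parent j == i).
  rewrite -(inj_eq (@ord_inj _)) /= inordK //.
  by have := bfs_parent_le j; have := ltn_ord j; nia.
rewrite (eq_bigr (fun j : 'I_m => if bfs_parent j == i then 1 else 0)); last first.
  by move=> j _; rewrite pE; case: (_ == _).
rewrite -big_mkcond /=; case: ifPn => [i0|i0].
  rewrite (big_bfs_parent _ (fun=> 1) i0) sum_nat_const_nat muln1 -(inj_eq (@ord_inj _)) /=.
  by case: eqP => _ /=; rewrite ?addn0 ?addn1 ?add0n.
rewrite big_pred0 ?add0n; last by move=> j; apply/eqP; have := bfs_parent_lt j; lia.
by rewrite -(inj_eq (@ord_inj _)) /=; lia.
Qed.

Lemma bfs_tree_interior (i : bfs_tree) : (i \in interior_vertices bfs_tree) = (i < n0).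
Proof.
rewrite !inE bfs_tree_deg; case: ifP => // i0.
by rewrite eqSS subn_eq0 -ltnNge /bfs_lo /bfs_hi; case: eqP => i1; nia.
Qed.

Lemma bfs_tree_class : supertree_class K.+1 D.+1 (m * K).+1 n0 bfs_tree.
Proof.
split; first by split; [exact: bfs_tree_supertree|exact: bfs_tree_uniform].
- by rewrite card_ord.
- rewrite -sum1_card (eq_bigl (fun i : 'I_(m * K).+1 => i < n0)); last exact: bfs_tree_interior.
  rewrite (big_nat_interval _ (fun=> 1) (a := 0) (b := n0) (P := fun i => i < n0)) //.
    by rewrite sum_nat_const_nat muln1 subn0.
  by have := interior_count_le; lia.
- move=> i; rewrite bfs_tree_interior => i0; rewrite bfs_tree_deg i0 ltnS /bfs_lo /bfs_hi.
  by case: eqP => i1; nia.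
Qed.

End BreadthFirstTree.

Import Order.TTheory GRing.Theory Num.Theory.
Local Open Scope ring_scope.

Definition energy (R : realType) (G : hypergraph) (k : nat) (f : G -> R) : R :=
  2^-1 * \sum_u \sum_(v | adj u v) (k.-1)%:R^-1 * (f u - f v) ^+ 2.

(** * Rearrangement *)

Section Energy.
Variables (R : realType) (G : hypergraph) (r : G) (m : nat) (E : nat -> {set G}).
Variables (tp : nat -> G) (ix hgt : G -> nat) (K : nat).
Hypothesis rt : rooting r m E tp ix hgt.
Hypothesis uG : k_uniform G K.+1.
Hypothesis K0 : (0 < K)%N.
Variable f : G -> R.

(** Adjacent vertices share exactly one edge; the vanishing diagonal lets [u] and [v] range freely
    over it. *)
Lemma rt_sum_adj (g : G -> G -> R) : (forall u, g u u = 0) ->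
  \sum_u \sum_(v | adj u v) g u v =
  \sum_(j < m) \sum_(u in E j) \sum_(v in E j) g u v.
Proof.
move=> g0; transitivity (\sum_(j < m) \sum_u \sum_v
    (if (u \in E j) && (v \in E j) then g u v else 0)).
  rewrite exchange_big; apply: eq_bigr => u _ /=.
  rewrite exchange_big big_mkcond; apply: eq_bigr => v _ /=.
  have [<-|uv] := eqVneq u v; first by rewrite g0 if_same big1 // => j _; rewrite if_same.
  case: ifPn => [/(rt_adjE rt uv)[j jm /and3P[uj vj _]]|nadj].
    rewrite (bigD1 (Ordinal jm)) //= uj vj big1 ?addr0 // => i ij.
    case: ifP => // /andP[ui vi]; case/eqP: ij; apply: val_inj.
    exact: (rt_edge_unique rt (ltn_ord i) jm uv ui vi uj vj).
  rewrite big1 // => j _; case: ifP => // /andP[uj vj]; case/negP: nadj.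
  rewrite /adj uv; apply/existsP; exists (E j).
  by rewrite (rt_edge rt) // uj vj.
apply: eq_bigr => j _; rewrite [RHS]big_mkcond; apply: eq_bigr => u _ /=.
case: (u \in E j) => /=; first by rewrite [RHS]big_mkcond.
by rewrite big1.
Qed.

Definition child_sum (j : nat) : R := \sum_(v | (v != r) && (ix v == j)) f v.

(** Over the ordered pairs of an edge, the squared differences add up to 2 (k sum f^2 - (sum f)^2),
    where k = K + 1. *)
Lemma energy_edges : energy K.+1 f =
  K%:R^-1 * \sum_(j < m) (K.+1%:R * (\sum_(v in E j) f v ^+ 2) - (\sum_(v in E j) f v) ^+ 2).
Proof.
rewrite /energy rt_sum_adj => [|u]; last by rewrite subrr expr0n mulr0.
rewrite !mulr_sumr; apply: eq_bigr => j _ /=.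
have -> : \sum_(u in E j) \sum_(v in E j) K%:R^-1 * (f u - f v) ^+ 2 =
   K%:R^-1 * \sum_(u in E j) \sum_(v in E j) (f u ^+ 2 + f v ^+ 2 - 2 * (f u * f v)).
  rewrite mulr_sumr; apply: eq_bigr => u _; rewrite mulr_sumr; apply: eq_bigr => v _.
  by congr (_ * _); ring.
have -> : \sum_(u in E j) \sum_(v in E j) (f u ^+ 2 + f v ^+ 2 - 2 * (f u * f v)) =
    2 * (K.+1%:R * \sum_(v in E j) f v ^+ 2 - (\sum_(v in E j) f v) ^+ 2).
  have cE : #|E j| = K.+1 by apply: uG; exact: (rt_edge rt).
  under eq_bigr => u _ do rewrite sumrB big_split /= sumr_const cE -mulr_sumr -mulr_sumr.
  rewrite sumrB big_split /= sumr_const cE -!mulr_sumr -mulr_suml sumrMnl.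
  by rewrite -[_ *+ _]mulr_natl; ring.
by rewrite mulrCA mulKf // pnatr_eq0.
Qed.

(** Every vertex but the root is a child in exactly one edge, so the squares of all children give
    sum f^2 except f(r)^2, which is moved to the left. *)
Lemma energy_tops :
  K%:R * energy K.+1 f + K.+1%:R * f r ^+ 2 =
  \sum_(j < m) (K%:R * f (tp j) ^+ 2 - 2 * f (tp j) * child_sum j - child_sum j ^+ 2)
  + K.+1%:R * \sum_v f v ^+ 2.
Proof.
rewrite energy_edges mulVKf ?pnatr_eq0 -?lt0n //.
rewrite (rt_big rt _ (fun v => f v ^+ 2)) /= mulrDr [in RHS]addrCA [LHS]addrC; congr (_ + _).
rewrite mulr_sumr -big_split /=; apply: eq_bigr => j _.
rewrite !(rt_big_edge rt _ _ (ltn_ord j)) /= -/(child_sum j) -natr1; ring.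
Qed.

End Energy.

(** * Sorted values, majorisation and Abel summation *)

Section SortedValues.
Variables (R : realType) (T : finType) (f : T -> R).
Hypothesis f0 : forall x, 0 <= f x.

Definition sorted_values (s : nat -> R) :=
  [/\ forall i j, (i <= j)%N -> s j <= s i, forall i, 0 <= s i
    & perm_eq [seq f x | x <- enum T] (mkseq s #|T|)].

Lemma sorted_values_exists : exists s, sorted_values s.
Proof.
pose t := sort >=%R [seq f x | x <- enum T].
have st : size t = #|T| by rewrite size_sort size_map cardE.
have t0 y : y \in t -> 0 <= y by rewrite mem_sort => /mapP[x _ ->].
have n0 i : 0 <= nth 0 t i.
  by have [ti|ti] := ltnP i (size t); [apply: t0; rewrite mem_nth|rewrite nth_default].
(* Padding with 0 beyond the list keeps the sequence nonincreasing, because [f] is nonnegative. *)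
exists (nth 0 t); split=> //.
  move=> i j ij; have [jt|jt] := ltnP j (size t); last by rewrite nth_default.
  apply: (sorted_leq_nth (leT := >=%R)) => //.
  - by move=> x y z xy yz; exact: le_trans yz xy.
  - by move=> x; exact: lexx.
  - by apply: sort_sorted => x y; exact: le_total.
  - by rewrite inE (leq_ltn_trans ij).
by rewrite -st mkseq_nth perm_sym perm_sort.
Qed.

Variable s : nat -> R.
Hypothesis sP : sorted_values s.

Lemma sorted_values_big (V : Type) (idx : V) (op : Monoid.com_law idx) (h : R -> V) :
  \big[op/idx]_x h (f x) = \big[op/idx]_(i < #|T|) h (s i).
Proof.
case: sP => _ _ pe.
transitivity (\big[op/idx]_(y <- [seq f x | x <- enum T]) h y).
  by rewrite big_map big_enum.
by rewrite (perm_big _ pe) /= /mkseq big_map -(big_mkord xpredT (fun i => h (s i))) /index_iota subn0.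
Qed.

Lemma sorted_values_card (P : pred R) :
  #|[pred x | P (f x)]| = (\sum_(i < #|T|) P (s i))%N.
Proof.
rewrite -(sorted_values_big _ (fun y => nat_of_bool (P y))) -sum1_card big_mkcond /=.
by apply: eq_bigr => x _; rewrite inE; case: (P _).
Qed.

Lemma sorted_values_out x : exists2 i, (i < #|T|)%N & f x = s i.
Proof.
case: sP => _ _ /perm_mem/(_ (f x)); rewrite map_f ?mem_enum // => /esym/mapP[j].
by rewrite mem_iota => /andP[_ jn] ->; exists j.
Qed.

Lemma sorted_values_in i : (i < #|T|)%N -> exists x, f x = s i.
Proof.
move=> iT; case: sP => _ _ /perm_mem/(_ (s i)).
rewrite map_f ?mem_iota // => /mapP[x _ ->]; by exists x.
Qed.

(** For the threshold c = s_|A|, the largest |A| values sum to |A| c plus the sum of max(f - c, 0)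
    over all of [T], and [A] gives |A| c plus the sum of f - c over [A], which is termwise at most
    that. Termwise equality makes [A] an upper level set up to ties. *)
Lemma sum_le_top (A : {set T}) :
  \sum_(x in A) f x <= \sum_(i < #|A|) s i /\
  (\sum_(x in A) f x = \sum_(i < #|A|) s i ->
   exists c, forall x, if x \in A then c <= f x else f x <= c).
Proof.
case: sP => smono s0 _; set c := s #|A|.
pose pos (y : R) := Num.max (y - c) 0.
have topE : \sum_(i < #|A|) s i = \sum_x pos (f x) + #|A|%:R * c.
  rewrite (sorted_values_big _ pos) -(big_mkord xpredT s) -(big_mkord xpredT (fun i => pos (s i))).
  rewrite [X in _ = X + _](big_cat_nat (n := #|A|)) ?max_card //=.
  rewrite [X in _ = _ + X + _]big_nat_cond [X in _ = _ + X + _]big1 ?addr0; last first.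
    by move=> i /andP[/andP[Ai _] _]; apply/max_idPr; rewrite subr_le0 smono.
  rewrite (@eq_big_nat _ _ _ _ _ (fun i => pos (s i)) (fun i => s i - c)); last first.
    by move=> i /andP[_ iA]; apply/max_idPl; rewrite subr_ge0 smono // ltnW.
  by rewrite sumrB sumr_const_nat subn0 mulr_natl subrK.
have AE : \sum_(x in A) f x = \sum_x (if x \in A then f x - c else 0) + #|A|%:R * c.
  by rewrite -big_mkcond /= sumrB sumr_const mulr_natl subrK.
have posP x : (if x \in A then f x - c else 0) <= pos (f x).
  by case: ifP => _; rewrite le_max lexx ?orbT.
rewrite topE AE; split; first by rewrite lerD2r ler_sum.
move=> /addIr/esym eq0; exists c => x.
have h1 : forall i : T, true -> 0 <= pos (f i) - (if i \in A then f i - c else 0).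
  by move=> i _; rewrite subr_ge0.
have h2 : \sum_x (pos (f x) - (if x \in A then f x - c else 0)) = 0.
  by rewrite sumrB eq0 subrr.
have /eqP : pos (f x) - (if x \in A then f x - c else 0) = 0.
  by apply: (psumr_eq0P h1 h2).
rewrite subr_eq0 => /eqP.
case: ifP => _ pE.
  by rewrite -subr_ge0 -pE le_max lexx orbT.
by rewrite -subr_le0 -pE le_max lexx.
Qed.

End SortedValues.

Section Abel.
Variables (R : realType) (x y : nat -> R) (m : nat).
Hypothesis x0 : forall j, (j < m)%N -> 0 <= x j.
Hypothesis xmono : forall j, (j.+1 < m)%N -> x j.+1 <= x j.
Hypothesis y0 : forall t, (t <= m)%N -> 0 <= \sum_(j < t) y j.

Lemma abel n : \sum_(j < n.+1) x j * y j =
  x n * (\sum_(j < n.+1) y j) + \sum_(t < n) (x t - x t.+1) * (\sum_(j < t.+1) y j).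
Proof.
elim: n => [|n IH]; first by rewrite !big_ord_recr !big_ord0 /= !add0r addr0.
by rewrite big_ord_recr /= IH [\sum_(t < n.+1) (_ - _) * _]big_ord_recr /=
  [\sum_(j < n.+2) y j]big_ord_recr /=; ring.
Qed.

Lemma abel_ge0 : 0 <= \sum_(j < m) x j * y j.
Proof.
case: m x0 xmono y0 => [|n] x0' xm y0'; first by rewrite big_ord0.
rewrite abel; apply: addr_ge0; first by apply: mulr_ge0; [exact: x0'|exact: y0'].
apply: sumr_ge0 => t _; apply: mulr_ge0; last by apply: y0'; have := ltn_ord t; lia.
by rewrite subr_ge0; apply: xm; have := ltn_ord t; lia.
Qed.

(** All terms of the Abel sum are nonnegative, so each vanishes; at a strict descent of [x] the
    partial sum of [y] is the factor that does. *)
Lemma abel_eq0 j : \sum_(j < m) x j * y j = 0 ->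
  (j.+1 < m)%N -> x j.+1 < x j -> \sum_(i < j.+1) y i = 0.
Proof.
case: m x0 xmono y0 => // n x0' xm y0'.
have h t : (t < n)%N -> 0 <= (x t - x t.+1) * (\sum_(j < t.+1) y j).
  by move=> tn; rewrite mulr_ge0 ?subr_ge0 ?xm ?y0' //; lia.
rewrite abel => /eqP; rewrite paddr_eq0; last 2 first.
- by apply: mulr_ge0; [exact: x0'|exact: y0'].
- by apply: sumr_ge0 => t _; exact: h.
case/andP=> _ /eqP e0 jn xlt; rewrite ltnS in jn.
have /eqP : (x j - x j.+1) * (\sum_(i < j.+1) y i) = 0.
  by apply: (psumr_eq0P (fun (t : 'I_n) _ => h _ (ltn_ord t)) e0 (i := Ordinal jn)).
by rewrite mulf_eq0 subr_eq0 gt_eqF //= => /eqP.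
Qed.

End Abel.

Section Count.
Variables (G : hypergraph) (r : G) (m : nat) (E : nat -> {set G}).
Variables (tp : nat -> G) (ix hgt : G -> nat).
Hypothesis rt : rooting r m E tp ix hgt.
Local Open Scope nat_scope.

(** The edges at a vertex are those it tops and its parent edge, which only the root lacks; hence
    the successor on the right. *)
Lemma rt_count (P : pred G) : P r ->
  \sum_(j < m) P (tp j) + #|[pred v | P v]| = (\sum_(v | P v) deg v).+1.
Proof.
move=> Pr; under [in RHS]eq_bigr => v _ do rewrite (rt_deg rt).
rewrite big_split /= -addnS; congr (_ + _).
  rewrite exchange_big /=; apply: eq_bigr => j _.
  rewrite big_mkcond (bigD1 (tp j)) //= eqxx big1 ?addn0; first by case: (P _).
  by move=> v vt; rewrite eq_sym (negPf vt) if_same.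
rewrite -sum1_card (bigD1 r) //= [\sum_(v | P v) _](bigD1 r) //= eqxx add0n add1n.
by congr _.+1; apply: eq_bigr => v /andP[_ ->].
Qed.

Lemma rt_top_interior j : r \in interior_vertices G -> j < m ->
  tp j \in interior_vertices G.
Proof.
move=> rI jm; have [->//|tr] := eqVneq (tp j) r.
rewrite !inE (rt_deg rt) tr addn1 eqSS (bigD1 (Ordinal jm)) //= eqxx.
by rewrite add1n.
Qed.

Section BigPrefix.
Variables (T : Type) (idx : T) (op : Monoid.com_law idx).

Lemma rt_big_prefix t (g : G -> T) : t <= m ->
  \big[op/idx]_(v in [set v | (v == r) || (ix v < t)]%SET) g v =
  op (g r) (\big[op/idx]_(j < t) \big[op/idx]_(v | (v != r) && (ix v == j)) g v).
Proof.
move=> tm; rewrite big_mkcond (rt_big rt) /= inE eqxx; congr (op _ _).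
rewrite (big_ord_widen m (fun j => \big[op/idx]_(v | (v != r) && (ix v == j)) g v)) //.
rewrite [RHS]big_mkcond; apply: eq_bigr => j _.
rewrite (eq_bigr (fun v => if j < t then g v else idx)); last first.
  by move=> v /andP[/negPf vr /eqP vj]; rewrite inE vr vj.
by case: ifP => // _; rewrite big1.
Qed.

End BigPrefix.
End Count.

Definition block_sum (R : realType) (K : nat) (s : nat -> R) (j : nat) : R :=
  \sum_(l < K) s (j * K + l).+1.

Lemma sum_blocks (R : realType) (K : nat) (s : nat -> R) t :
  \sum_(i < (t * K).+1) s i = s 0 + \sum_(j < t) block_sum K s j.
Proof.
rewrite big_ord_recl /=; congr (_ + _).
elim: t => [|t IH]; first by rewrite !big_ord0.
rewrite [RHS]big_ord_recr /= -IH mulSn addnC.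
rewrite -(big_mkord xpredT (fun i => s i.+1)) (big_cat_nat (n := (t * K)%N)) ?leq_addr //=.
rewrite big_mkord; congr (_ + _).
rewrite -{1}[(t * K)%N]add0n big_addn big_mkord addKn.
by apply: eq_bigr => l _; rewrite addnC.
Qed.

Lemma bfs_tree_energy (R : realType) (K D m n0 : nat) (h : nat -> R) :
  (0 < K)%N -> (0 < D)%N -> (0 < n0)%N -> (n0 * D < m)%N ->
  K%:R * energy K.+1 (fun i : bfs_tree K D m n0 => h i) + K.+1%:R * h 0 ^+ 2 =
  \sum_(j < m) (K%:R * h (bfs_parent D n0 j) ^+ 2 - 2 * h (bfs_parent D n0 j) * block_sum K h j
     - block_sum K h j ^+ 2) + K.+1%:R * \sum_(i < (m * K).+1) h i ^+ 2.
Proof.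
move=> K0 D0 n00 n0m.
have := energy_tops (bfs_tree_rooting K0 D0 n00 n0m) (bfs_tree_uniform K0 D0 n00 n0m) K0 (fun i => h i).
move=> /= ->; congr (_ + _); apply: eq_bigr => j _.
rewrite inordK; last by have := bfs_parent_le D n0 j; have := ltn_ord j; nia.
have -> // : child_sum (G := bfs_tree K D m n0) ord0 (fun i => i.-1 %/ K)%N (fun i => h i) j = block_sum K h j.
exact: (big_bfs_child K0 D0 n00 n0m _ h (ltn_ord j)).
Qed.

(** * Comparison of a supertree with the breadth-first tree *)

Section Compare.
Variables (R : realType) (G : hypergraph) (r : G) (m : nat).
Variables (K D n0 : nat) (f : G -> R) (s : nat -> R) (hgt : G -> nat).
Hypothesis uG : k_uniform G K.+1.
Hypotheses (K0 : (0 < K)%N) (D0 : (0 < D)%N) (n00 : (0 < n0)%N).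
Hypothesis f0 : forall v, 0 <= f v.
Hypothesis fmax : forall v, f v <= f r.
Hypothesis fb : forall v, v \in boundary_vertices G -> f v = 0.
Hypothesis rI : r \in interior_vertices G.
Hypothesis cI : #|interior_vertices G| = n0.
Hypothesis dI : forall v, v \in interior_vertices G -> (D < deg v)%N.
Hypothesis sP : sorted_values f s.

Lemma sorted_value0 : s 0 = f r.
Proof.
have [smono _ _] := sP; apply/eqP; rewrite eq_le; apply/andP; split.
  have [|x <-] := sorted_values_in sP (i := 0); last exact: fmax.
  by apply/card_gt0P; exists r.
by have [i _ ->] := sorted_values_out sP r; exact: smono.
Qed.

Lemma interior_pos v : 0 < f v -> v \in interior_vertices G.
Proof.
move=> fv; rewrite inE; apply/negP => /fb fv0.
by rewrite fv0 ltxx in fv.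
Qed.

Lemma sorted_value_exterior i : (n0 <= i)%N -> (i < #|G|)%N -> s i = 0.
Proof.
move=> ni iG; have [smono s0 _] := sP; apply/eqP; rewrite eq_le s0 andbT leNgt.
apply/negP => si.
have : (#|[pred v | (0 < f v)%R]| <= n0)%N.
  rewrite -cI; apply: subset_leq_card; apply/subsetP => v; rewrite inE.
  exact: interior_pos.
rewrite (sorted_values_card sP (fun y => 0 < y)).
have : (i.+1 <= \sum_(j < #|G|) (0 < s j)%R)%N; last by move: ni; clear; lia.
rewrite -{1}[i.+1]muln1 -{1}(card_ord i.+1) -sum_nat_const.
rewrite (big_ord_widen #|G| (fun=> 1%N)) // big_mkcond; apply: leq_sum => j _.
case: ifP => // ji; rewrite (lt_le_trans si) ?smono //.
Qed.

Section Prefix.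
Variables (E : nat -> {set G}) (tp : nat -> G) (ix : G -> nat).
Hypothesis rt : rooting r m E tp ix hgt.
Local Notation cs := (child_sum r ix f).
Local Notation B := (block_sum K s).

Lemma rt_order : #|G| = (m * K).+1.
Proof. exact: (rt_card rt uG). Qed.

(** The root and the children of the first [t] edges are tK + 1 vertices, and s_0 with the first [t]
    blocks are the tK + 1 largest values. *)
Lemma prefix_le t : (t <= m)%N -> 0 <= \sum_(j < t) (B j - cs j) /\
  (\sum_(j < t) (B j - cs j) = 0 ->
   exists c, forall v, v != r -> if (ix v < t)%N then c <= f v else f v <= c).
Proof.
move=> tm; pose A := [set v | (v == r) || (ix v < t)%N]%SET.
have cA : #|A| = (t * K).+1.
  rewrite -sum1_card (rt_big_prefix rt _ _ tm) (eq_bigr (fun=> K)).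
    by rewrite sum_nat_const card_ord.
  by move=> j _; apply: (rt_card_children rt uG); apply: leq_trans tm.
have sA : \sum_(v in A) f v = f r + \sum_(j < t) cs j.
  by rewrite (rt_big_prefix rt _ _ tm).
have [] := sum_le_top sP A; rewrite cA sA sum_blocks sorted_value0 lerD2l => le eq.
rewrite sumrB subr_ge0; split=> // /eqP; rewrite subr_eq0 => /eqP e.
have [|c cP] := eq; first by rewrite e.
by exists c => v vr; have := cP v; rewrite inE (negPf vr).
Qed.

End Prefix.

Section Enumeration.
Variables (E : nat -> {set G}) (tp : nat -> G) (ix : G -> nat).
Hypothesis rt : rooting r m E tp ix hgt.
Local Notation cs := (child_sum r ix f).
Local Notation B := (block_sum K s).

Lemma edge_count : (n0 * D < m)%N.
Proof.
have := rt_count rt rI (P := mem (interior_vertices G)).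
have -> : (\sum_(j < m) (tp j \in interior_vertices G) = m)%N.
  rewrite (eq_bigr (fun=> 1%N)) ?sum1_card ?card_ord // => j _.
  by rewrite (rt_top_interior rt).
have : (n0 * D.+1 <= \sum_(v in interior_vertices G) deg v)%N.
  by rewrite -cI -sum_nat_const; apply: leq_sum => v /dI.
by rewrite cI => h /= e; clear -h e; nia.
Qed.

Hypothesis psort : forall j, (j.+1 < m)%N -> f (tp j.+1) <= f (tp j).

Lemma psort_le i j : (i <= j)%N -> (j < m)%N -> f (tp j) <= f (tp i).
Proof.
elim: j => [|j IH]; first by rewrite leqn0 => /eqP->.
rewrite leq_eqVlt => /predU1P[->//|ij jm].
by apply: le_trans (psort jm) (IH _ _) => //; exact: ltnW.
Qed.

(** Let i be the parent index. If this failed, more than i vertices would have value at least s_i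
    and together top at least (i + 1) D + 1 edges, all before edge [j]. An edge so late has parent i
    only if i is the last interior index, but then all interior vertices, [tp j] included, have
    value at least s_i. *)
Lemma top_value_ge j : (j < m)%N -> s (bfs_parent D n0 j) <= f (tp j).
Proof.
move=> jm; have [smono s0 _] := sP; set i := bfs_parent D n0 j; set a := s i.
have := s0 i; rewrite le_eqVlt => /predU1P[a0|a0]; first by rewrite /a -a0.
rewrite leNgt; apply/negP => pa.
have m0 := edge_count; have i0 : (i < n0)%N by exact: (bfs_parent_lt D n00).
have iG : (i < #|G|)%N by rewrite (rt_order rt) ltnS (leq_trans (ltnW i0)) // (interior_count_le K0 D0).
pose P := [pred v | a <= f v].
have Pr : P r by rewrite /= -sorted_value0 smono.
have cP : (i < #|[pred v | P v]|)%N.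
  rewrite (sorted_values_card sP (fun y => a <= y)).
  rewrite -{1}[i.+1]muln1 -{1}(card_ord i.+1) -sum_nat_const.
  rewrite (big_ord_widen #|G| (fun=> 1%N)) // big_mkcond; apply: leq_sum => l _.
  by case: ifP => // li; rewrite smono.
have PI v : P v -> v \in interior_vertices G.
  by move=> av; apply: interior_pos; apply: lt_le_trans av.
have dP : (#|[pred v | P v]| * D.+1 <= \sum_(v | P v) deg v)%N.
  by rewrite -sum_nat_const; apply: leq_sum => v /PI/dI.
have cE := rt_count rt Pr.
have cj : (\sum_(l < m) P (tp l) <= j)%N.
  have jE : j = (\sum_(l < j) 1)%N by rewrite sum1_card card_ord.
  rewrite [leqRHS]jE (big_ord_widen m (fun=> 1%N) (ltnW jm)) [leqRHS]big_mkcond; apply: leq_sum => l _.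
  have [//|jl] := ltnP l j; first by case: (P _).
  by rewrite leqn0 eqb0 -ltNge /= (le_lt_trans _ pa) // psort_le.
have ci : (i.+1 * D < j)%N by nia.
have : (i.+1 <= j.-1 %/ D)%N by rewrite leq_divRL //; lia.
move=> ij; have iE : i = n0.-1 by rewrite /i /bfs_parent in ij *; lia.
have sub : [pred v | P v] \subset interior_vertices G.
  by apply/subsetP => v /PI.
have ceq : #|[pred v | P v]| = #|interior_vertices G|.
  apply/eqP; rewrite eqn_leq subset_leq_card //=.
  by rewrite cI; apply: leq_trans cP; rewrite iE prednK.
have /(subset_cardP ceq) PI' := sub.
have : P (tp j) by rewrite -[P _]/(tp j \in [pred v | P v]) PI' (rt_top_interior rt).
by rewrite /= leNgt pa.
Qed.

(** The children of edge [j] carry numbers above [j], hence above their parent. *)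
Lemma block_le j : (j < m)%N -> B j <= K%:R * s (bfs_parent D n0 j).
Proof.
have [smono _ _] := sP => jm.
apply: (@le_trans _ _ (\sum_(l < K) s (bfs_parent D n0 j))).
  apply: ler_sum => l _; apply: smono; have := bfs_parent_le D n0 j; nia.
by rewrite sumr_const card_ord mulr_natl.
Qed.

(* The three sums are nonnegative by counting the edges with a large top value,
   by rearrangement, and by majorisation respectively. *)
Lemma energy_diff :
  K%:R * (energy K.+1 f - energy K.+1 (fun i : bfs_tree K D m n0 => s i)) =
  \sum_(j < m) (f (tp j) - s (bfs_parent D n0 j)) *
     (K%:R * (f (tp j) + s (bfs_parent D n0 j)) - 2 * B j)
  + 2 * \sum_(j < m) f (tp j) * (B j - cs j)
  + \sum_(j < m) (B j ^+ 2 - cs j ^+ 2).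
Proof.
have e1 := energy_tops rt uG K0 f.
have e2 := bfs_tree_energy s K0 D0 n00 edge_count.
have sq : \sum_(i < (m * K).+1) s i ^+ 2 = \sum_v f v ^+ 2.
  by rewrite -(rt_order rt) (sorted_values_big sP _ (fun y => y ^+ 2)).
rewrite sorted_value0 sq in e2.
apply: (@addIr _ (K.+1%:R * f r ^+ 2 - K.+1%:R * \sum_v f v ^+ 2)).
transitivity ((K%:R * energy K.+1 f + K.+1%:R * f r ^+ 2 - K.+1%:R * \sum_v f v ^+ 2)
   - K%:R * energy K.+1 (fun i : bfs_tree K D m n0 => s i)); first by ring.
rewrite e1 addrK.
apply: (@addIr _ (K%:R * energy K.+1 (fun i : bfs_tree K D m n0 => s i) + K.+1%:R * f r ^+ 2)).
rewrite [in RHS]e2 addrA subrK.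
transitivity (\sum_(j < m)
   (K%:R * f (tp j) ^+ 2 - 2 * f (tp j) * cs j - cs j ^+ 2) + K.+1%:R * f r ^+ 2) => //.
rewrite -[in RHS]addrA [X in _ = _ + X](_ : _ = \sum_(j < m)
  (K%:R * s (bfs_parent D n0 j) ^+ 2 - 2 * s (bfs_parent D n0 j) * B j - B j ^+ 2)
   + K.+1%:R * f r ^+ 2); last by ring.
rewrite addrA; congr (_ + _); rewrite mulr_sumr -!big_split /=.
by apply: eq_bigr => j _; ring.
Qed.

Hypothesis csort : forall j, (j.+1 < m)%N -> f (tp j.+1) = f (tp j) -> cs j.+1 <= cs j.

Variables (E2 : nat -> {set G}) (tp2 : nat -> G) (ix2 : G -> nat).
Hypothesis rt2 : rooting r m E2 tp2 ix2 hgt.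
Local Notation cs2 := (child_sum r ix2 f).
Hypothesis cs2sort : forall j, (j.+1 < m)%N -> cs2 j.+1 <= cs2 j.
Hypothesis cs2perm : perm_eq (mkseq cs m) (mkseq cs2 m).

(** Squares ignore the order of the edges, so the child sums may be taken sorted; the linear part is
    then within reach of Abel summation. *)
Lemma sum_squares : \sum_(j < m) (B j ^+ 2 - cs j ^+ 2) =
  \sum_(j < m) (B j - cs2 j) ^+ 2 + 2 * \sum_(j < m) cs2 j * (B j - cs2 j).
Proof.
have h : \sum_(j < m) cs j ^+ 2 = \sum_(j < m) cs2 j ^+ 2.
  rewrite -(big_mkord xpredT (fun j => cs j ^+ 2)) -(big_mkord xpredT (fun j => cs2 j ^+ 2)).
  rewrite /index_iota subn0 -(big_map cs xpredT (fun y => y ^+ 2)).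
  by rewrite -(big_map cs2 xpredT (fun y => y ^+ 2)); exact: perm_big.
rewrite sumrB h -sumrB mulr_sumr -big_split /=.
by apply: eq_bigr => j _; ring.
Qed.

(** Bound B by K s and use K (p + s) - 2 K s = K (p - s). The square makes a vanishing term force p
    = s. *)
Lemma tops_term_ge j : (j < m)%N -> K%:R * (f (tp j) - s (bfs_parent D n0 j)) ^+ 2 <=
  (f (tp j) - s (bfs_parent D n0 j)) * (K%:R * (f (tp j) + s (bfs_parent D n0 j)) - 2 * B j).
Proof.
move=> jm; rewrite expr2 mulrCA ler_wpM2l ?subr_ge0 ?top_value_ge //.
by have := block_le jm; lra.
Qed.

Lemma energy_compare :
  energy K.+1 (fun i : bfs_tree K D m n0 => s i) <= energy K.+1 f /\
  (energy K.+1 (fun i : bfs_tree K D m n0 => s i) = energy K.+1 f ->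
   [/\ forall j, (j < m)%N -> f (tp j) = s (bfs_parent D n0 j),
       forall j, (j < m)%N -> cs j = B j
     & forall t, (t <= m)%N -> exists c, forall v, v != r ->
         if (ix v < t)%N then c <= f v else f v <= c]).
Proof.
have KR : 0 < K%:R :> R by rewrite ltr0n.
have d1 (j : 'I_m) : 0 <= (f (tp j) - s (bfs_parent D n0 j)) *
     (K%:R * (f (tp j) + s (bfs_parent D n0 j)) - 2 * B j).
  apply: le_trans (tops_term_ge (ltn_ord j)).
  by rewrite mulr_ge0 ?sqr_ge0 ?ltW.
have D1 : 0 <= \sum_(j < m) (f (tp j) - s (bfs_parent D n0 j)) *
     (K%:R * (f (tp j) + s (bfs_parent D n0 j)) - 2 * B j).
  by apply: sumr_ge0 => j _; exact: d1.
have pre t (tm : (t <= m)%N) := (prefix_le rt tm).1.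
have pre2 t (tm : (t <= m)%N) := (prefix_le rt2 tm).1.
have D2 : 0 <= \sum_(j < m) f (tp j) * (B j - cs j).
  by apply: (@abel_ge0 _ (fun j => f (tp j)) (fun j => B j - cs j)) => // j; exact: psort.
have D3 : 0 <= \sum_(j < m) cs2 j * (B j - cs2 j).
  by apply: (@abel_ge0 _ cs2 (fun j => B j - cs2 j)) => // j _; apply: sumr_ge0.
have D4 : 0 <= \sum_(j < m) (B j - cs2 j) ^+ 2 by apply: sumr_ge0 => j _; exact: sqr_ge0.
have := energy_diff; rewrite sum_squares.
set T1 := \sum_(j < m) _ in D1 *; set T2 := \sum_(j < m) f _ * _ in D2 *.
set T3 := \sum_(j < m) cs2 _ * _ in D3 *; set T4 := \sum_(j < m) _ ^+ 2 in D4 *.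
move=> eD; split.
  by rewrite -subr_ge0 -(pmulr_rge0 _ KR) eD; lra.
move=> eE; rewrite eE subrr mulr0 in eD.
have t1 : T1 = 0 by lra.
have t2 : T2 = 0 by lra.
have t4 : T4 = 0 by lra.
have P1 j : (j < m)%N -> f (tp j) = s (bfs_parent D n0 j).
  move=> jm; have := tops_term_ge jm.
  rewrite (psumr_eq0P (fun (t : 'I_m) _ => d1 t) t1 (i := Ordinal jm)) // pmulr_rle0 //.
  by move=> le0; apply/eqP; rewrite -subr_eq0 -sqrf_eq0 eq_le le0 sqr_ge0.
have P2 j : (j < m)%N -> cs2 j = B j.
  move=> jm; apply/eqP; rewrite eq_sym -subr_eq0 -sqrf_eq0; apply/eqP.
  exact: (psumr_eq0P (fun (t : 'I_m) _ => sqr_ge0 (B t - cs2 t)) t4 (i := Ordinal jm)).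
(* At a strict drop of the top values, equality in the Abel sum yields a threshold separating the
   children before and after the drop; where tops are tied, [csort] applies. So [cs] is sorted and
   coincides with its permutation [cs2]. *)
have csm j : (j.+1 < m)%N -> cs j.+1 <= cs j.
  move=> jm; have := psort jm; rewrite le_eqVlt => /predU1P[|plt]; first exact: csort.
  have z : \sum_(i < j.+1) (B i - cs i) = 0.
    apply: (@abel_eq0 _ (fun j => f (tp j)) (fun j => B j - cs j) m) => // i; exact: psort.
  have [c cP] := (prefix_le rt (ltnW jm)).2 z.
  have Kc i : (i < m)%N -> \sum_(v | (v != r) && (ix v == i)) c = c *+ K.
    move=> im; rewrite -(rt_card_children rt uG im) sum1_card sumr_const.
    by congr (_ *+ _); apply: eq_card => v; rewrite !inE.
  apply: (@le_trans _ _ (c *+ K)).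
    rewrite -(Kc j.+1) //; apply: ler_sum => v /andP[vr /eqP vj].
    by have := cP v vr; rewrite vj ltnn.
  rewrite -(Kc j) 1?ltnW //; apply: ler_sum => v /andP[vr /eqP vj].
  by have := cP v vr; rewrite vj ltnSn.
have csE : mkseq cs m = mkseq cs2 m.
  apply: (@sorted_eq _ >=%R) => //.
  - by move=> x y z xy yz; exact: le_trans yz xy.
  - by move=> x y; rewrite andbC => /le_anti.
  - apply/(sortedP 0) => j; rewrite size_mkseq => jm.
    by rewrite (nth_mkseq 0 cs jm) (nth_mkseq 0 cs (ltnW jm)) /= csm.
  - apply/(sortedP 0) => j; rewrite size_mkseq => jm.
    by rewrite (nth_mkseq 0 cs2 jm) (nth_mkseq 0 cs2 (ltnW jm)) /= cs2sort.
have P3 j : (j < m)%N -> cs j = B j.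
  by move=> jm; rewrite -P2 // -(nth_mkseq 0 cs jm) csE nth_mkseq.
split=> // t tm; apply: (prefix_le rt tm).2.
rewrite big1 // => j _; rewrite P3 ?subrr //.
exact: leq_trans (ltn_ord j) tm.
Qed.

End Enumeration.
End Compare.

(** * Equality in the comparison *)

Section Minimizer.
Variables (R : realType) (G : hypergraph) (k : nat).
Implicit Type f : G -> R.

Lemma norm_sq_gt0 f : (exists v, f v != 0) -> 0 < \sum_v f v ^+ 2.
Proof.
case=> v fv; rewrite (bigD1 v) //= ltr_pwDl ?exprn_even_gt0 //.
by apply: sumr_ge0 => w _; exact: sqr_ge0.
Qed.

Lemma first_eigenvalue_le f : dirichlet_admissible f ->
  first_eigenvalue G R k <= rayleigh k f.
Proof.
move=> fA; have [|g [gA -> gmin]] := @first_eigenvalue_min R G k; last exact: gmin.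
case: fA => [[v fv] fb]; apply/set0Pn; exists v; rewrite inE.
by apply: contra fv => /fb->.
Qed.

Lemma energy_abs f : energy k (fun v => `|f v|) <= energy k f.
Proof.
rewrite /energy ler_wpM2l // ?invr_ge0 //; apply: ler_sum => u _; apply: ler_sum => v _.
rewrite ler_wpM2l // ?invr_ge0 //.
rewrite -[leRHS]real_normK ?num_real // -[leLHS]real_normK ?num_real //.
by rewrite ler_pXn2r ?nnegrE //; exact: ler_dist_dist.
Qed.

(** The absolute value of a minimiser is again one: it keeps the norm and does not raise the
    energy. *)
Lemma nonneg_minimizer : interior_vertices G != finset.set0 ->
  exists f, [/\ dirichlet_admissible f, forall v, 0 <= f v
    & first_eigenvalue G R k = rayleigh k f].
Proof.
move=> I0; have [f [fA fE _]] := @first_eigenvalue_min R G k I0.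
have aA : dirichlet_admissible (fun v => `|f v|).
  case: fA => [[v fv] fb]; split; first by exists v; rewrite normr_eq0.
  by move=> w /fb ->; rewrite normr0.
exists (fun v => `|f v|); split=> //.
apply/eqP; rewrite eq_le first_eigenvalue_le //= fE.
rewrite -[leLHS]/(energy k (fun v => `|f v|) / _) -[leRHS]/(energy k f / _).
have -> : \sum_v `|f v| ^+ 2 = \sum_v f v ^+ 2.
  by apply: eq_bigr => v _; rewrite real_normK ?num_real.
by rewrite ler_wpM2r ?energy_abs // invr_ge0 ltW // norm_sq_gt0 //; case: fA.
Qed.

End Minimizer.

Lemma linear_coef_eq0 (R : realFieldType) (a b : R) :
  (forall t, 0 <= b * t + a * t ^+ 2) -> b = 0.
Proof.
move=> h; apply/eqP/negPn/negP => b0.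
(* As [c] is positive and exceeds [a], the choice t = - b / c makes the expression negative. *)
set c := `|a| + 1; have c0 : 0 < c by rewrite ltr_wpDl.
have := h (- b / c); rewrite leNgt => /negP; apply.
have -> : b * (- b / c) + a * (- b / c) ^+ 2 = (b / c) ^+ 2 * (a - c).
  by field; rewrite gt_eqF.
have bc : b / c != 0 by rewrite mulf_neq0 ?invr_eq0 // gt_eqF.
rewrite pmulr_rlt0; last by rewrite exprn_even_gt0.
by rewrite subr_lt0 /c (le_lt_trans (ler_norm a)) // ltrDl.
Qed.

(** * The eigenvalue equation of a minimiser *)

Section Critical.
Variables (R : realType) (G : hypergraph) (r : G) (m : nat) (E : nat -> {set G}).
Variables (tp : nat -> G) (ix hgt : G -> nat) (K : nat).
Hypothesis rt : rooting r m E tp ix hgt.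
Hypothesis uG : k_uniform G K.+1.
Hypothesis K0 : (0 < K)%N.
Variable f : G -> R.
Hypothesis fA : dirichlet_admissible f.
Hypothesis fmin : first_eigenvalue G R K.+1 = rayleigh K.+1 f.
Local Notation lam := (first_eigenvalue G R K.+1).

(** First variation of the Rayleigh quotient in the direction of the indicator of [u]. The edge sums
    at [u] add up to deg(u) f(u) plus the values of the neighbours, so this is L f(u) = lambda f(u)
    multiplied by K and rearranged. *)
Lemma critical_equation u : u \in interior_vertices G ->
  \sum_(j < m | u \in E j) \sum_(v in E j) f v =
  (K.+1%:R * (deg u)%:R - lam * K%:R) * f u.
Proof.
move=> uI; pose g t v := f v + t * (v == u)%:R.
have sum_bump (A : {set G}) t : \sum_(v in A) g t v = \sum_(v in A) f v + t * (u \in A)%:R.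
  rewrite big_split /= -mulr_sumr; congr (_ + _ * _).
  rewrite big_mkcond (bigD1 u) //= eqxx big1 ?addr0; first by case: (u \in A).
  by move=> v /negPf->; rewrite if_same.
have sum_bump_sq (A : {set G}) t : \sum_(v in A) g t v ^+ 2 =
    \sum_(v in A) f v ^+ 2 + (2 * t * f u + t ^+ 2) * (u \in A)%:R.
  transitivity (\sum_(v in A) (f v ^+ 2 + (2 * t * f u + t ^+ 2) * (v == u)%:R)).
    by apply: eq_bigr => v _; rewrite /g; have [->|_] := eqVneq v u; rewrite /=; ring.
  rewrite big_split /= -mulr_sumr; congr (_ + _ * _).
  rewrite big_mkcond (bigD1 u) //= eqxx big1 ?addr0; first by case: (u \in A).
  by move=> v /negPf->; rewrite if_same.
have K1 : K%:R != 0 :> R by rewrite pnatr_eq0 -lt0n.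
have eE t : K%:R * energy K.+1 (g t) = K%:R * energy K.+1 f +
   (2 * t * (K.+1%:R * (deg u)%:R * f u - \sum_(j < m | u \in E j) \sum_(v in E j) f v)
    + t ^+ 2 * (K%:R * (deg u)%:R)).
  rewrite !(energy_edges rt uG) !mulVKf //.
  have -> : (deg u)%:R = \sum_(j < m) (u \in E j)%:R :> R.
    by rewrite /deg (rt_enum_edges rt) natr_sum.
  rewrite [\sum_(j < m | u \in E j) _]big_mkcond.
  rewrite !mulr_sumr mulr_suml -sumrB !mulr_sumr -!big_split /=.
  apply: eq_bigr => j _; rewrite sum_bump sum_bump_sq -natr1.
  by case: (u \in E j) => /=; ring.
have nE t : \sum_v g t v ^+ 2 = \sum_v f v ^+ 2 + (2 * t * f u + t ^+ 2).
  have := sum_bump_sq setT t; rewrite inE mulr1.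
  by under eq_bigl => v do rewrite inE; under [in RHS]eq_bigl => v do rewrite inE.
have N0 := norm_sq_gt0 fA.1.
have eL : energy K.+1 f = lam * \sum_v f v ^+ 2.
  by rewrite fmin /rayleigh -/(energy _ _) divfK // gt_eqF.
have ge t : lam * \sum_v g t v ^+ 2 <= energy K.+1 (g t).
  have [[v gv]|g0] := pselect (exists v, g t v != 0); last first.
    rewrite [X in _ * X]big1 ?mulr0 => [|v _].
      rewrite /energy mulr_ge0 ?invr_ge0 //; apply: sumr_ge0 => x _; apply: sumr_ge0 => y _.
      by rewrite mulr_ge0 ?invr_ge0 ?sqr_ge0.
    by apply/eqP; rewrite sqrf_eq0; apply/negPn/negP => gv; apply: g0; exists v.
  rewrite -ler_pdivlMr ?norm_sq_gt0 //; last by exists v.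
  apply: first_eigenvalue_le; split; first by exists v.
  move=> w wb; rewrite /g (fA.2 w wb) add0r; case: eqP => [wu|]; last by rewrite mulr0.
  by move: uI; rewrite inE -wu wb.
have lin : forall t, 0 <=
    (2 * (K.+1%:R * (deg u)%:R * f u - \sum_(j < m | u \in E j) \sum_(v in E j) f v
      - lam * K%:R * f u)) * t + (K%:R * (deg u)%:R - lam * K%:R) * t ^+ 2.
  move=> t; have := ge t; rewrite -(ler_pM2l (x := K%:R)) ?ltr0n // eE nE eL -subr_ge0.
  by congr (0 <= _); ring.
have := linear_coef_eq0 lin.
by set X := \sum_(j < m | _) _ => h; lra.
Qed.

End Critical.

(** * Ties in the sorted eigenfunction of the breadth-first tree *)

Section Ties.
Variables (R : realType) (K D m n0 : nat) (s : nat -> R) (mu : R).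
Hypotheses (K0 : (0 < K)%N) (D0 : (0 < D)%N) (n00 : (0 < n0)%N) (n0m : (n0 * D < m)%N).
Hypothesis smono : forall i j, (i <= j)%N -> s j <= s i.
Hypothesis s0 : forall i, 0 <= s i.
Hypothesis sout : forall i, (n0 <= i)%N -> (i < (m * K).+1)%N -> s i = 0.
Hypothesis s00 : 0 < s 0.
Local Notation par := (bfs_parent D n0).
Local Notation lo := (bfs_lo D).
Local Notation hi := (bfs_hi D m n0).
Local Notation B := (block_sum K s).
Local Notation F := (fun j => s (par j) + B j).
Hypothesis eigen_eq : forall i, (i < n0)%N ->
  F (i.-1 %/ K)%N + \sum_(lo i <= j < hi i) F j =
  (K.+1%:R * (hi i - lo i).+1%:R - mu) * s i.

Lemma edge_value_mono i j : (i <= j)%N -> F j <= F i.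
Proof.
move=> ij; apply: lerD; first by apply: smono; exact: bfs_parent_mono.
by apply: ler_sum => l _; apply: smono; rewrite ltnS leq_add2r leq_mul2r ij orbT.
Qed.

Lemma edge_value_ge0 j : 0 <= F j.
Proof. by apply: addr_ge0 => //; apply: sumr_ge0. Qed.

(** At a zero value all edge sums vanish, so the parent has value zero too; climbing ends at s_0 >
    0. *)
Lemma interior_values_gt0 i : (i < n0)%N -> 0 < s i.
Proof.
elim/ltn_ind: i => i IH i0; rewrite lt_neqAle s0 andbT eq_sym; apply/eqP => si.
have := eigen_eq i0; rewrite si mulr0 => /eqP; rewrite paddr_eq0; last 2 first.
- exact: edge_value_ge0.
- by apply: sumr_ge0 => j _; exact: edge_value_ge0.
case/andP=> + _; rewrite paddr_eq0 //; last exact: sumr_ge0.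
case/andP=> /eqP sp _; case: i IH i0 si sp => [|i] IH i0 si sp; first by have := s00; rewrite si ltxx.
have pi : (par (i %/ K) <= i)%N by apply: leq_trans (bfs_parent_le _ _ _) (leq_div _ _).
by have := IH (par (i %/ K)) pi (bfs_parent_lt D n00 _); rewrite sp ltxx.
Qed.

(* Subtract the equations at [i] and [i.+1] and compare the sums of the monotone
   sequence [F] term by term. *)
Lemma tie_adjacent i : (i.+1 < n0)%N -> s i = s i.+1 ->
  (i.+2 = n0 -> m = (n0 * D).+1) /\
  (forall j, (i * D < j)%N -> (j <= i.+2 * D)%N -> F j = F (i * D).+1).
Proof.
move=> i1 si; have i0 := ltnW i1; have sp := interior_values_gt0 i0.
have hiE : hi i = (i.+1 * D).+1 by rewrite /bfs_hi; case: eqP => //; lia.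
have loE : lo i.+1 = (i.+1 * D).+1 by [].
have hlo : ((i.+2 * D).+1 <= hi i.+1)%N by rewrite /bfs_hi; case: eqP => // ?; nia.
(* [c] counts the edges that [i.+1], if it is the last interior vertex, has beyond the usual [D];
   their children are exterior, so each edge sum is the top value alone. *)
set c := (hi i.+1 - (i.+2 * D).+1)%N.
have sumlast : \sum_((i.+2 * D).+1 <= j < hi i.+1) F j = s i *+ c.
  rewrite /c -sumr_const_nat; apply: eq_big_nat => j /andP[j1 j2].
  have i2 : i.+2 = n0 by move: j2; rewrite /bfs_hi; case: eqP => //; lia.
  have jm : (j < m)%N by move: j2; rewrite /bfs_hi i2 eqxx.
  have -> : par j = i.+1.
    apply/eqP; rewrite (bfs_parentE K0 D0 n00 n0m) //; last by lia.
    by rewrite j2 andbT /bfs_lo; nia.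
  rewrite si [X in _ + X]big1 ?addr0 // => l _; apply: sout.
    have := ltn_ord l; nia.
  have := ltn_ord l; nia.
have shift a : \sum_((a * D).+1 <= j < (a.+1 * D).+1) F j = \sum_(l < D) F ((a * D).+1 + l)%N.
  rewrite -{1}[(a * D).+1]addn0 addnC big_addn big_mkord.
  have -> : ((a.+1 * D).+1 - (a * D).+1 = D)%N by rewrite mulSn; lia.
  by apply: eq_bigr => l _; rewrite addnC.
have e1 := eigen_eq i0; have e2 := eigen_eq i1.
rewrite hiE shift in e1; rewrite /bfs_lo (big_cat_nat (n := (i.+2 * D).+1)) //= in e2; last by nia.
rewrite shift sumlast in e2.
have hd1 : ((i.+1 * D).+1 - lo i = D)%N by rewrite /bfs_lo mulSn; lia.
have hd2 : (hi i.+1 - (i.+1 * D).+1 = D + c)%N.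
  by rewrite /c; move: hlo; rewrite [(i.+2 * D)%N]mulSn; lia.
rewrite hd1 in e1; rewrite hd2 -si in e2.
have Fup : F (i %/ K)%N <= F (i.-1 %/ K)%N by apply: edge_value_mono; apply: leq_div2r; exact: leq_pred.
have dl (l : 'I_D) : 0 <= F ((i * D).+1 + l)%N - F ((i.+1 * D).+1 + l)%N.
  by rewrite subr_ge0; apply: edge_value_mono; nia.
have dsum : \sum_(l < D) (F ((i * D).+1 + l)%N - F ((i.+1 * D).+1 + l)%N) =
   F (i %/ K)%N - F (i.-1 %/ K)%N - K%:R * c%:R * s i.
  rewrite sumrB; move: e1 e2 => /=.
  set S1 := \sum_(l < D) _; set S2 := \sum_(l < D) _.
  rewrite -mulr_natl -!natr1 natrD.
  by move=> e1 e2; apply/eqP; rewrite -subr_eq0; apply/eqP; lra.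
(* In [dsum] the left side is nonnegative termwise and the right side is nonpositive; so every term
   vanishes, and [c] with them. *)
have dge : 0 <= \sum_(l < D) (F ((i * D).+1 + l)%N - F ((i.+1 * D).+1 + l)%N).
  by apply: sumr_ge0 => l _; exact: dl.
have KcR : 0 <= K%:R * c%:R * s i by rewrite !mulr_ge0.
have kc0 : K%:R * c%:R * s i = 0 by rewrite dsum in dge; lra.
have c0 : c = 0%N.
  move/eqP: kc0; rewrite !mulf_eq0 !pnatr_eq0 (gt_eqF sp) orbF.
  by case/orP => /eqP // k0; move: K0; rewrite k0.
have d0 : \sum_(l < D) (F ((i * D).+1 + l)%N - F ((i.+1 * D).+1 + l)%N) = 0.
  by rewrite dsum in dge *; lra.
have Fl l : (l < D)%N -> F ((i * D).+1 + l)%N = F ((i.+1 * D).+1 + l)%N.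
  move=> lD; apply/eqP; rewrite -subr_eq0; apply/eqP.
  exact: (psumr_eq0P (fun (t : 'I_D) _ => dl t) d0 (i := Ordinal lD)).
split.
  move=> i2; have : hi i.+1 = (i.+2 * D).+1 by move: c0; rewrite /c; lia.
  by rewrite /bfs_hi i2 eqxx.
(* Each value of [F] recurs [D] places later, so the monotone [F] is constant on both blocks. *)
move=> j ij ji; apply/eqP; rewrite eq_le edge_value_mono //=.
apply: (@le_trans _ _ (F (i.+2 * D)%N)); last exact: edge_value_mono.
have -> : (i.+2 * D = (i.+1 * D).+1 + D.-1)%N by rewrite mulSn; lia.
rewrite -[leRHS]Fl ?prednK //.
have := Fl 0%N D0; rewrite !addn0 => ->; apply: edge_value_mono.
by rewrite mulSn; lia.
Qed.

(** The ranges of successive adjacent ties overlap in a block of [D] edges, so their constants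
    agree. *)
Lemma tie_run i1 i2 : (i1 < i2)%N -> (i2 < n0)%N -> s i1 = s i2 ->
  (i2.+1 = n0 -> m = (n0 * D).+1) /\
  (forall j, (i1 * D < j)%N -> (j <= i2.+1 * D)%N -> F j = F (i1 * D).+1).
Proof.
elim: i2 => // i2 IH; rewrite ltnS => i12 i2n si.
have s2 : s i2 = s i2.+1.
  by apply/eqP; rewrite eq_le -{1}si !smono.
have [h1 h2] := tie_adjacent i2n s2; split=> // j j1 j2.
move: i12; rewrite leq_eqVlt => /predU1P[i12|i12]; first by rewrite i12 in j1 *; exact: h2.
have [_ h3] := IH i12 (ltnW i2n) (etrans si (esym s2)).
have [ji|ji] := leqP j (i2.+1 * D); first exact: h3.
rewrite h2 //; last by rewrite (leq_ltn_trans _ ji) // leq_mul2r leqnSn orbT.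
apply: h3; first by rewrite ltnS leq_mul2r (ltnW i12) orbT.
by rewrite mulSn; lia.
Qed.

(** The indices [l] and [l'] witness a genuine tie: otherwise [par j] and [par j'] could be one
    vertex, whose children may differ. Edge 0 is excluded because the range in [tie_run] starts
    after it. *)
Lemma tie_block_sums j j' l l' : (0 < j)%N -> (j <= j')%N -> (j' < m)%N ->
  s (par j) = s (par j') -> (l < l')%N -> (l' < (m * K).+1)%N ->
  s l = s (par j) -> s l' = s (par j) -> B j = B j'.
Proof.
move=> j0 jj jm sp ll lm sl sl'.
have pj := bfs_parent_lt D n00 j; have pj' := bfs_parent_lt D n00 j'.
have ln0 : (l' < n0)%N.
  rewrite ltnNge; apply/negP => nl; have := interior_values_gt0 pj.
  by rewrite -sl' sout // ltxx.
pose i1 := minn l (par j); pose i2 := maxn l' (par j').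
have s1 : s i1 = s (par j) by rewrite /i1 /minn; case: ifP.
have s2 : s i2 = s (par j) by rewrite /i2 /maxn; case: ifP.
have i12 : (i1 < i2)%N by rewrite /i1 /i2; lia.
have i2n : (i2 < n0)%N by rewrite /i2; lia.
have [h1 h2] := tie_run i12 i2n (etrans s1 (esym s2)).
have pjD x : (0 < x)%N -> (par x * D < x)%N.
  move=> x0; have := leq_trunc_div x.-1 D.
  have : (par x * D <= x.-1 %/ D * D)%N by rewrite leq_mul2r geq_minr orbT.
  by lia.
have lej : (i1 * D < j)%N.
  by apply: leq_ltn_trans (pjD j j0); rewrite leq_mul2r geq_minr orbT.
have gej : (j' <= i2.+1 * D)%N.
  have [i2e|i2e] := eqVneq i2.+1 n0; first by move: jm; rewrite h1 // i2e.
  have pi2 : (par j' <= i2)%N by rewrite leq_maxr.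
  have pE : par j' = (j'.-1 %/ D)%N.
    have : (par j' < n0.-1)%N by move/eqP: i2e; clearbody i2; lia.
    by rewrite /bfs_parent; clear; lia.
  have : (j'.-1 < (j'.-1 %/ D).+1 * D)%N by rewrite -ltn_divLR.
  have : ((j'.-1 %/ D).+1 * D <= i2.+1 * D)%N.
    by rewrite leq_mul2r -pE ltnS leq_maxr orbT.
  by lia.
have := h2 j lej (leq_trans jj gej); have <- := h2 j' (leq_trans lej jj) gej.
by rewrite sp => /addrI.
Qed.

Lemma last_value_lt i : (i.+2 = n0)%N -> m != (n0 * D).+1 -> s i.+1 < s i.
Proof.
move=> i2 mD; rewrite lt_neqAle smono // andbT; apply: contra mD => /eqP si.
by apply/eqP; apply: (tie_adjacent _ (esym si)).1; rewrite -i2.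
Qed.

End Ties.

(* The truncated [i.-1] makes edge 0 play the part of a parent edge of the root,
   so that one formula covers all interior vertices. *)
Lemma bfs_tree_eigen_eq (R : realType) (K D m n0 : nat) (s : nat -> R) :
  (0 < K)%N -> (0 < D)%N -> (0 < n0)%N -> (n0 * D < m)%N ->
  dirichlet_admissible (fun i : bfs_tree K D m n0 => s i) ->
  first_eigenvalue (bfs_tree K D m n0) R K.+1 =
    rayleigh K.+1 (fun i : bfs_tree K D m n0 => s i) ->
  forall i, (i < n0)%N ->
  s (bfs_parent D n0 (i.-1 %/ K)%N) + block_sum K s (i.-1 %/ K)%N +
    \sum_(bfs_lo D i <= j < bfs_hi D m n0 i) (s (bfs_parent D n0 j) + block_sum K s j) =
  (K.+1%:R * (bfs_hi D m n0 i - bfs_lo D i).+1%:R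
     - first_eigenvalue (bfs_tree K D m n0) R K.+1 * K%:R) * s i.
Proof.
move=> K0 D0 n00 n0m sA smin i i0.
have ile : (i < (m * K).+1)%N by rewrite ltnS (leq_trans (ltnW i0)) // (interior_count_le K0 D0 n0m).
have rt := bfs_tree_rooting K0 D0 n00 n0m.
pose u : bfs_tree K D m n0 := Ordinal ile.
have uI : u \in interior_vertices (bfs_tree K D m n0) by rewrite bfs_tree_interior.
have := critical_equation rt (bfs_tree_uniform K0 D0 n00 n0m) K0 sA smin uI.
rewrite bfs_tree_deg //= i0 => <-.
pose F j := s (bfs_parent D n0 j) + block_sum K s j.
have parm (j : 'I_m) : (bfs_parent D n0 j < (m * K).+1)%N.
  by have := bfs_parent_le D n0 j; have := ltn_ord j; nia.
rewrite (eq_bigr (fun j : 'I_m => F j)); last first.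
  move=> j _; rewrite (rt_big_edge rt _ _ (ltn_ord j)) /= inordK //.
  by congr (_ + _); exact: (big_bfs_child K0 D0 n00 n0m _ s (ltn_ord j)).
have uj (j : 'I_m) : (u \in bfs_edge K D m n0 j) = (bfs_parent D n0 j == i) || (u != ord0) && (i.-1 %/ K == j)%N.
  by rewrite inE /= eq_sym.
rewrite (eq_bigl _ _ uj) (bigID (fun j : 'I_m => bfs_parent D n0 j == i)) /=.
rewrite (eq_bigl (fun j : 'I_m => bfs_parent D n0 j == i)); last first.
  by move=> j; rewrite andbC; case: eqP.
rewrite (big_bfs_parent K0 D0 n00 n0m _ F i0) /= addrAC; congr (_ + _).
case: i i0 ile @u uI uj => [|i] i0 ile u uI uj /=.
  rewrite div0n big_pred0 ?addr0 // => j.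
  by case: eqP.
rewrite add0r.
have jm : (i %/ K < m)%N by rewrite ltn_divLR //; lia.
rewrite (big_pred1 (Ordinal jm)) // => j /=.
rewrite -(inj_eq val_inj) /=; case: eqP => /= [pj|_].
  apply/esym/eqP => ji; have := bfs_parent_le D n0 j; rewrite pj ji.
  by have := leq_div i K; lia.
by rewrite andbT eq_sym.
Qed.

(** * Optimality of the breadth-first tree *)

Section Existence.
Variables (R : realType) (K D n n0 : nat) (G : hypergraph).
Hypotheses (K0 : (0 < K)%N) (D0 : (0 < D)%N) (n00 : (0 < n0)%N).
Hypothesis GC : supertree_class K.+1 D.+1 n n0 G.

Lemma class_size : n = (#|edges G| * K).+1 /\ (n0 * D < #|edges G|)%N.
Proof.
have [[stG uG] nE cI dI] := GC.
have [r rI] : exists r, r \in interior_vertices G.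
  by apply/card_gt0P; rewrite cI.
have [top [up [rt _ _ _ _]]] := supertree_rooting r stG uG K0.
have {}rt := rt _ (perm_refl _); rewrite -cardE in rt.
split; first by rewrite -nE (rt_card rt uG).
exact: (edge_count rI cI dI rt).
Qed.

(** Used in both directions: the inequality makes [bfs_tree] optimal, and the last clause describes
    every supertree that does as well. *)
Lemma optimal_comparison : let m := #|edges G| in
  exists (r : G) (f : G -> R) (s : nat -> R) E tp ix,
  [/\ rooting r m E tp ix (height r)
      /\ (forall v, v != r -> height r v = (height r (tp (ix v))).+1),
      [/\ r \in interior_vertices G, forall v, 0 <= f v, forall v, f v <= f r,
          forall v, v \in boundary_vertices G -> f v = 0 & sorted_values f s],
      dirichlet_admissible (fun i : bfs_tree K D m n0 => s i),
      first_eigenvalue (bfs_tree K D m n0) R K.+1 <= first_eigenvalue G R K.+1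
    & first_eigenvalue G R K.+1 <= first_eigenvalue (bfs_tree K D m n0) R K.+1 ->
      [/\ first_eigenvalue (bfs_tree K D m n0) R K.+1 =
            rayleigh K.+1 (fun i : bfs_tree K D m n0 => s i),
          forall j, (j < m)%N -> f (tp j) = s (bfs_parent D n0 j),
          forall j, (j < m)%N -> child_sum r ix f j = block_sum K s j
        & forall t, (t <= m)%N -> exists c, forall v, v != r ->
            if (ix v < t)%N then c <= f v else f v <= c]].
Proof.
move=> m; have [nm n0m] := class_size; have [[stG uG] nE cI dI] := GC.
have I0 : interior_vertices G != finset.set0 by rewrite -cards_eq0 cI -lt0n.
have [f [fA f0 fE]] := nonneg_minimizer R K.+1 I0.
have [v0 fv0] := fA.1.
have [r _ fmax] := @arg_maxP _ _ G v0 xpredT f isT.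
have {}fmax v : f v <= f r by exact: fmax.
have fr : 0 < f r by apply: lt_le_trans (fmax v0); rewrite lt_neqAle eq_sym fv0 f0.
have fb := fA.2.
have rI := interior_pos fb fr.
have [s sP] := sorted_values_exists f0.
have [top [up [rt upE chE hE h0]]] := supertree_rooting r stG uG K0.
pose S e := \sum_(v | (v != r) && (up v == e)) f v.
(* Breaking ties of top values by child sums provides [csort] for [energy_compare]. *)
pose le1 (e e' : {set G}) := (f (top e') < f (top e)) || (f (top e) == f (top e')) && (S e' <= S e).
pose le2 (e e' : {set G}) := S e' <= S e.
have le1_total : total le1.
  move=> e e'; rewrite /le1; have [||] := ltgtP (f (top e)) (f (top e')); rewrite ?orbT //= => _.
  exact: le_total.
have le1_trans : transitive le1.
  move=> e2 e1 e3 /orP[l12|/andP[/eqP e12 s12]] /orP[l23|/andP[/eqP e23 s23]]; rewrite /le1.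
  - by rewrite (lt_trans l23 l12).
  - by rewrite -e23 l12.
  - by rewrite e12 l23.
  - by rewrite e12 e23 eqxx (le_trans s23 s12) orbT.
pose es := sort le1 (enum (edges G)); pose es2 := sort le2 (enum (edges G)).
have pes : perm_eq es (enum (edges G)) by rewrite perm_sort.
have pes2 : perm_eq es2 (enum (edges G)) by rewrite perm_sort.
have ses : size es = m by rewrite size_sort -cardE.
have ses2 : size es2 = m by rewrite size_sort -cardE.
have rt1 := rt _ pes; have rt2 := rt _ pes2; rewrite ses in rt1; rewrite ses2 in rt2.
have csE es' : perm_eq es' (enum (edges G)) -> forall j, (j < size es')%N ->
    child_sum r (fun v => index (up v) es') f j = S (nth finset.set0 es' j).
  move=> pe j jm; apply: eq_bigl => v; have [//|vr /=] := eqVneq v r.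
  have upin : up v \in es' by rewrite (perm_mem pe) mem_enum; case: (upE v vr).
  apply/eqP/eqP => [<-|->]; first by rewrite nth_index.
  by rewrite index_uniq // (perm_uniq pe) enum_uniq.
have sor1 j : (j.+1 < m)%N -> le1 (nth finset.set0 es j) (nth finset.set0 es j.+1).
  move=> jm; have /(sortedP finset.set0) := sort_sorted le1_total (enum (edges G)).
  by apply; rewrite -/es ses.
have sor2 j : (j.+1 < m)%N -> le2 (nth finset.set0 es2 j) (nth finset.set0 es2 j.+1).
  move=> jm; have /(sortedP finset.set0) : sorted le2 es2.
    by apply: sort_sorted => e e'; exact: le_total.
  by apply; rewrite ses2.
have mkE es' : perm_eq es' (enum (edges G)) -> size es' = m ->
    mkseq (child_sum r (fun v => index (up v) es') f) m = map S es'.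
  move=> pe se; apply: (@eq_from_nth _ 0); first by rewrite size_mkseq size_map.
  move=> j; rewrite size_mkseq => jm; rewrite nth_mkseq // (nth_map finset.set0) ?se //.
  by rewrite csE // se.
have [le eq] : energy K.+1 (fun i : bfs_tree K D m n0 => s i) <= energy K.+1 f /\
  (energy K.+1 (fun i : bfs_tree K D m n0 => s i) = energy K.+1 f ->
   [/\ forall j, (j < m)%N -> f (top (nth finset.set0 es j)) = s (bfs_parent D n0 j),
       forall j, (j < m)%N -> child_sum r (fun v => index (up v) es) f j = block_sum K s j
     & forall t, (t <= m)%N -> exists c, forall v, v != r ->
         if (index (up v) es < t)%N then c <= f v else f v <= c]).
  apply: (energy_compare uG K0 D0 n00 f0 fmax fb rI cI dI sP rt1 _ _ rt2).
  - by move=> j /sor1 /orP[/ltW|/andP[/eqP->]].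
  - move=> j jm pE; rewrite !csE ?ses //; last exact: ltnW.
    by have /orP[|/andP[_]] := sor1 j jm; first by rewrite pE ltxx.
  - by move=> j jm; rewrite !csE ?ses2 //; [exact: sor2|exact: ltnW].
  - by rewrite !mkE //; apply: perm_map; rewrite (perm_trans pes) // perm_sym.
have cG := rt_card rt1 uG.
have sA : dirichlet_admissible (fun i : bfs_tree K D m n0 => s i).
  split; first by exists ord0; rewrite /= (sorted_value0 fmax sP) gt_eqF.
  move=> i ib; apply: (sorted_value_exterior fb cI sP); last by rewrite cG; exact: ltn_ord.
  rewrite leqNgt -(bfs_tree_interior K0 D0 n00 n0m) !inE negbK.
  by move: ib; rewrite !inE.
have NE : \sum_(i : bfs_tree K D m n0) s i ^+ 2 = \sum_v f v ^+ 2.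
  by rewrite (sorted_values_big sP _ (fun y => y ^+ 2)) cG.
have N0 := norm_sq_gt0 fA.1.
have rE : rayleigh K.+1 (fun i : bfs_tree K D m n0 => s i) =
   energy K.+1 (fun i : bfs_tree K D m n0 => s i) / \sum_v f v ^+ 2 by rewrite -NE.
have rfE : rayleigh K.+1 f = energy K.+1 f / \sum_v f v ^+ 2 by [].
have lb := first_eigenvalue_le K.+1 sA.
have rr : rayleigh K.+1 (fun i : bfs_tree K D m n0 => s i) <= rayleigh K.+1 f.
  by rewrite rE rfE ler_pM2r ?invr_gt0.
exists r, f, s, (nth finset.set0 es), (fun j => top (nth finset.set0 es j)), (fun v => index (up v) es).
split=> //.
- split=> // v vr; rewrite hE // nth_index // (perm_mem pes) mem_enum.
  by case: (upE v vr).
- by rewrite fE; apply: le_trans lb rr.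
move=> le'; have e1 : first_eigenvalue (bfs_tree K D m n0) R K.+1 =
            rayleigh K.+1 (fun i : bfs_tree K D m n0 => s i).
  by apply/eqP; rewrite eq_le lb (le_trans rr) // -fE.
have e2 : energy K.+1 (fun i : bfs_tree K D m n0 => s i) = energy K.+1 f.
  apply/eqP; rewrite eq_le le /=.
  by move: le'; rewrite e1 rE fE rfE ler_pM2r ?invr_gt0.
by have [? ? ?] := eq e2.
Qed.

End Existence.

Lemma sum_const_eq (T : finType) (P : pred T) (g : T -> nat) c :
  (forall v, P v -> c <= g v)%N -> (\sum_(v | P v) g v <= #|[pred v | P v]| * c)%N ->
  forall v, P v -> g v = c.
Proof.
move=> cg le v Pv; apply/eqP; rewrite eqn_leq cg // andbT.
have h : (\sum_(w | P w && (w != v)) c <= \sum_(w | P w && (w != v)) g w)%N.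
  by apply: leq_sum => w /andP[Pw _]; exact: cg.
have : (#|[pred v | P v]| * c = c + \sum_(w | P w && (w != v)) c)%N.
  by rewrite -sum_nat_const (bigD1 v).
by move: le; rewrite (bigD1 v) //=; move: h; clear; lia.
Qed.

(* Vertices are compared by decreasing value, ties by comparing the parents;
   the fuel n bounds the number of generations climbed. *)
Fixpoint before (R : realType) (G : hypergraph) (r : G) (tp : nat -> G)
    (ix : G -> nat) (f : G -> R) (n : nat) (u v : G) : bool :=
  if n is n'.+1 then
    (v != r) && [|| u == r, f v < f u | (f u == f v) &&
      (before r tp ix f n' (tp (ix u)) (tp (ix v)) ||
       (tp (ix u) == tp (ix v)) && ((ix u < ix v)%N ||
         (ix u == ix v) && (enum_rank u < enum_rank v)%N))]
  else false.

(** * The SLO-ordering of a minimiser *)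

Section Order.
Variables (R : realType) (G : hypergraph) (r : G) (m : nat) (E : nat -> {set G}).
Variables (tp : nat -> G) (ix : G -> nat) (K D n0 : nat) (f : G -> R) (s : nat -> R).
Hypothesis rt : rooting r m E tp ix (height r).
Hypothesis hE : forall v, v != r -> height r v = (height r (tp (ix v))).+1.
Hypothesis h0 : height r r = 0%N.
Hypothesis uG : k_uniform G K.+1.
Hypotheses (K0 : (0 < K)%N) (D0 : (0 < D)%N) (n00 : (0 < n0)%N).
Hypothesis fmax : forall v, f v <= f r.
Hypothesis fb : forall v, v \in boundary_vertices G -> f v = 0.
Hypothesis rI : r \in interior_vertices G.
Hypothesis cI : #|interior_vertices G| = n0.
Hypothesis dI : forall v, v \in interior_vertices G -> (D < deg v)%N.
Hypothesis sP : sorted_values f s.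
Hypothesis topE : forall j, (j < m)%N -> f (tp j) = s (bfs_parent D n0 j).
Hypothesis childE : forall j, (j < m)%N -> child_sum r ix f j = block_sum K s j.
Hypothesis prefix : forall t, (t <= m)%N -> exists c, forall v, v != r ->
  if (ix v < t)%N then c <= f v else f v <= c.
Hypothesis spos : forall i, (i < n0)%N -> 0 < s i.
Hypothesis tieP : forall j j' l l', (0 < j)%N -> (j <= j')%N -> (j' < m)%N ->
  s (bfs_parent D n0 j) = s (bfs_parent D n0 j') -> (l < l')%N -> (l' < (m * K).+1)%N ->
  s l = s (bfs_parent D n0 j) -> s l' = s (bfs_parent D n0 j) -> block_sum K s j = block_sum K s j'.
Hypothesis last_lt : forall i, i.+2 = n0 -> m != (n0 * D).+1 -> s i.+1 < s i.

Let cG : #|G| = (m * K).+1 := rt_card rt uG.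
Let n0m : (n0 * D < m)%N := edge_count rI cI dI rt.

Lemma interior_lt_order : (n0 < #|G|)%N.
Proof. by rewrite cG ltnS (interior_count_le K0 D0 n0m). Qed.

Lemma interior_gt0 v : v \in interior_vertices G -> 0 < f v.
Proof.
have sub : [pred v | (0 < f v)] \subset interior_vertices G.
  by apply/subsetP => w fw; apply: (interior_pos fb).
have ceq : #|[pred v | 0 < f v]| = #|interior_vertices G|.
  apply/eqP; rewrite eqn_leq subset_leq_card //= cI (sorted_values_card sP (fun y => 0 < y)).
  have nE : n0 = (\sum_(i < n0) 1)%N by rewrite sum1_card card_ord.
  rewrite [leqLHS]nE (big_ord_widen #|G| (fun=> 1%N) (ltnW interior_lt_order)) big_mkcond.
  by apply: leq_sum => i _; case: ifP => // /spos ->.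
by have /(subset_cardP ceq) e := sub; rewrite -e.
Qed.

(** Unless m = n0 D + 1, the last interior value is strictly smallest when n0 > 1. By [topE] the
    other n0 - 1 interior vertices top exactly (n0 - 1) D + 1 edges, and [rt_count] then leaves no
    room for a degree above D + 1 among them. *)
Lemma interior_degrees :
  (forall v, v \in interior_vertices G -> deg v = D.+1) \/
  (exists2 z, z \in interior_vertices G &
     forall v, v \in interior_vertices G -> v != z -> deg v = D.+1 /\ f z < f v).
Proof.
have [smono _ _] := sP.
have [mE|mD] := eqVneq m (n0 * D).+1.
  left; apply: (@sum_const_eq _ (mem (interior_vertices G))); first exact: dI.
  have := rt_count rt rI (P := mem (interior_vertices G)).
  have -> : (\sum_(j < m) (tp j \in interior_vertices G) = m)%N.
    rewrite (eq_bigr (fun=> 1%N)) ?sum1_card ?card_ord // => j _.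
    by rewrite (rt_top_interior rt).
  have -> : #|[pred v | (mem (interior_vertices G)) v]| = n0 by rewrite -cI; apply: eq_card.
  move: mE; set X := (\sum_(v | _) _)%N; clear; nia.
right; have [n01|n01] := eqVneq n0 1%N.
  exists r => // v vI vr; have : (1 < #|interior_vertices G|)%N.
    by apply/card_gt1P; exists v, r.
  by rewrite cI n01.
case: (n0) n01 n00 cI spos topE last_lt mD n0m interior_lt_order => // -[//|n1] _ _ cI' spos' topE' last' mD n0m' nG.
have slt := last' n1 erefl mD; set a := s n1.+1 in slt.
pose P := [pred v | a < f v].
have Pr : P r by rewrite /= -(sorted_value0 fmax sP) (lt_le_trans slt) // smono.
have PI v : P v -> v \in interior_vertices G.
  by move=> av; apply: (interior_pos fb); apply: le_lt_trans av; apply/ltW/spos'.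
have cP : #|[pred v | P v]| = n1.+1.
  rewrite (sorted_values_card sP (fun y => a < y)).
  rewrite (eq_bigr (fun i : 'I_#|G| => if (i < n1.+1)%N then 1 else 0)%N); last first.
    move=> i _; case: ltnP => i1; last by rewrite ltNge smono.
    by rewrite (lt_le_trans slt) // smono.
  rewrite -big_mkcond -(big_ord_widen #|G| (fun=> 1%N)) ?sum1_card ?card_ord //.
  by move: nG; clear; lia.
have cT : (\sum_(j < m) P (tp j) = (n1.+1 * D).+1)%N.
  rewrite (eq_bigr (fun j : 'I_m => if (bfs_parent D n1.+2 j < n1.+1)%N then 1 else 0)%N); last first.
    move=> j _; rewrite /= topE' //; case: ltnP => pj.
      by rewrite (lt_le_trans slt) // smono.
    by rewrite ltNge smono.
  rewrite -big_mkcond (big_nat_interval _ (fun=> 1%N) (a := 0) (b := (n1.+1 * D).+1)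
     (P := fun j => bfs_parent D n1.+2 j < n1.+1)%N).
  - by rewrite sum_nat_const_nat muln1 subn0.
  - by move: n0m'; clear; nia.
  - move=> j jm; case: j jm => [|j] jm; first by rewrite bfs_parent0.
    have := bfs_parentE K0 D0 (ltn0Sn n1.+1) n0m' (ltnSn n1.+1) (ltn0Sn j) jm.
    rewrite /bfs_lo /bfs_hi eqxx jm andbT leq0n /=.
    by have := bfs_parent_lt D (ltn0Sn n1.+1) j.+1; clear; lia.
have dP := @sum_const_eq _ P (@deg G) D.+1.
have := rt_count rt Pr; rewrite cT cP => dS.
have {}dP v : P v -> deg v = D.+1.
  apply: dP; first by move=> w /PI/dI.
  by rewrite cP; move: dS; set X := (\sum_(v | _) _)%N; clear; nia.
have sub : [set v in [pred v | P v]] \subset interior_vertices G.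
  by apply/subsetP => v; rewrite inE => /PI.
have : #|interior_vertices G :\: [set v in [pred v | P v]]| = 1%N.
  by rewrite cardsD (setIidPr sub) cI' cardsE cP subSnn.
move=> /eqP/cards1P[z zE].
have : z \in interior_vertices G :\: [set v in [pred v | P v]] by rewrite zE set11.
rewrite inE => /andP[zP zI]; exists z => // v vI vz.
have Pv : P v.
  apply: contraNT vz => Pv; rewrite -in_set1 -zE inE vI andbT.
  by rewrite inE.
split; first exact: dP.
by apply: le_lt_trans Pv; rewrite leNgt; apply: contra zP => Pz; rewrite inE.
Qed.

Lemma child_ge u v : u != r -> v != r -> (ix u < ix v)%N -> f v <= f u.
Proof.
move=> ur vr uv; have um : ((ix u).+1 <= m)%N := rt_ix rt ur.
have [c cP] := prefix um.
have := cP u ur; rewrite ltnSn => cu; have := cP v vr.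
by rewrite ltnS leqNgt uv /= => /le_trans; apply.
Qed.

(** A threshold separates the children of edge [i] from those of edge [j]; equal sums of K terms put
    all of them on it. *)
Lemma child_sum_eq i j : (i < j)%N -> (j < m)%N ->
  child_sum r ix f i = child_sum r ix f j ->
  forall u v, u != r -> v != r -> ix u = i -> ix v = j -> f u = f v.
Proof.
move=> ij jm e; have im := ltn_trans ij jm.
have [c cP] := prefix im.
have Kc l : (l < m)%N -> \sum_(v | (v != r) && (ix v == l)) c = c *+ K.
  move=> lm; rewrite -(rt_card_children rt uG lm) sum1_card sumr_const.
  by congr (_ *+ _); apply: eq_card => v; rewrite !inE.
have gi u : (u != r) && (ix u == i) -> 0 <= f u - c.
  by move=> /andP[ur /eqP ui]; have := cP u ur; rewrite ui ltnSn subr_ge0.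
have gj u : (u != r) && (ix u == j) -> 0 <= c - f u.
  by move=> /andP[ur /eqP ui]; have := cP u ur; rewrite ui ltnS leqNgt ij subr_ge0.
have si : \sum_(u | (u != r) && (ix u == i)) (f u - c) = child_sum r ix f i - c *+ K.
  by rewrite sumrB Kc.
have sj : \sum_(u | (u != r) && (ix u == j)) (c - f u) = c *+ K - child_sum r ix f j.
  by rewrite sumrB Kc.
have si0 : 0 <= child_sum r ix f i - c *+ K by rewrite -si; exact: sumr_ge0.
have sj0 : 0 <= c *+ K - child_sum r ix f j by rewrite -sj; exact: sumr_ge0.
have ei : \sum_(u | (u != r) && (ix u == i)) (f u - c) = 0 by rewrite si; move: e si0 sj0; lra.
have ej : \sum_(u | (u != r) && (ix u == j)) (c - f u) = 0 by rewrite sj; move: e si0 sj0; lra.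
move=> u v ur vr ui vj.
have /eqP : f u - c = 0 by apply: (psumr_eq0P gi ei); rewrite ur ui eqxx.
have /eqP : c - f v = 0 by apply: (psumr_eq0P gj ej); rewrite vr vj eqxx.
by rewrite !subr_eq0 => /eqP <- /eqP.
Qed.

Lemma two_values x y : x != y -> f x = f y ->
  exists l l', [/\ (l < l')%N, (l' < (m * K).+1)%N, s l = f x & s l' = f x].
Proof.
move=> xy fxy; have : (1 < #|[pred v | f v == f x]|)%N.
  by apply/card_gt1P; exists x, y; rewrite !inE -fxy eqxx.
rewrite (sorted_values_card sP (fun z => z == f x)) => c1.
have : (1 < #|[set i : 'I_#|G| | s i == f x]|)%N.
  by rewrite -sum1dep_card big_mkcond; apply: leq_trans c1 _; apply: leq_sum => i _; case: eqP.
case/card_gt1P => i [j []]; rewrite !inE => /eqP si /eqP sj ij.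
have := ltn_ord i; have := ltn_ord j; rewrite [X in (_ < X)%N]cG => jm im.
rewrite [X in (_ < X)%N]cG in im.
case: (ltngtP i j) => h; last by case/eqP: ij; apply: val_inj.
  by exists i, j.
by exists j, i.
Qed.

Lemma top_mono i j : (i <= j)%N -> (j < m)%N -> f (tp j) <= f (tp i).
Proof.
have [smono _ _] := sP => ij jm; rewrite !topE //; last exact: leq_ltn_trans jm.
by apply: smono; exact: bfs_parent_mono.
Qed.

Lemma rt_has_child j : (j < m)%N -> exists2 v, v != r & ix v = j.
Proof.
move=> jm; have := rt_card_children rt uG jm; rewrite sum1_card => c.
have : (0 < #|[pred v | (v != r) && (ix v == j)]|)%N by rewrite c.
by case/card_gt0P => v; rewrite inE => /andP[vr /eqP vj]; exists v.
Qed.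

Lemma tied_children x y i j u v : x != y -> f x = f y -> (0 < i)%N -> (i < j)%N -> (j < m)%N ->
  f (tp i) = f x -> f (tp j) = f x -> u != r -> v != r -> ix u = i -> ix v = j ->
  f u = f v.
Proof.
move=> xy fxy i0 ij jm ti tj ur vr ui vj; have im := ltn_trans ij jm.
have [l [l' [ll lm sl sl']]] := two_values xy fxy.
apply: (child_sum_eq ij jm) => //.
have pij : s (bfs_parent D n0 i) = s (bfs_parent D n0 j) by rewrite -!topE // ti tj.
have si : f x = s (bfs_parent D n0 i) by rewrite -topE.
by rewrite !childE //; apply: (tieP i0 (ltnW ij) jm pij ll lm); rewrite ?sl ?sl' si.
Qed.

(* Edges with tied tops have constant children, except possibly edge 0. *)
Lemma root_first_edge x u v : ix u = 0%N -> u != r -> v != r -> (0 < ix v)%N -> x = tp 0 ->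
  f (tp (ix v)) = f x -> f v < f u -> x = r.
Proof.
move=> u0 ur vr v0 x0 fvx fvu; apply/eqP/negPn/negP => xr.
have m0 : (0 < m)%N by rewrite (leq_ltn_trans _ (rt_ix rt vr)).
have fxr : f x = f r by rewrite x0 topE // bfs_parent0 (sorted_value0 fmax sP).
have vm := rt_ix rt vr.
(* The root has degree above D >= 1 and no parent edge, so it tops two edges; neither is edge 0,
   whose top is [x]. *)
have [g [g' [gg [gm gr] [g'm g'r]]]] : exists g g', [/\ (g < g')%N, (g < m)%N /\ tp g = r & (g' < m)%N /\ tp g' = r].
  have := dI rI; rewrite (rt_deg rt) eqxx addn0 => dr.
  have : (1 < #|[set j : 'I_m | tp j == r]|)%N.
    rewrite -sum1dep_card big_mkcond; have d1 : (1 < D.+1)%N := D0.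
    by apply: leq_trans (leq_trans d1 dr) _; apply: leq_sum => j _; case: eqP.
  case/card_gt1P => i [j []]; rewrite !inE => /eqP si /eqP sj ij.
  case: (ltngtP i j) => h; last by case/eqP: ij; apply: val_inj.
    by exists i, j.
  by exists j, i.
have pos l : (l < m)%N -> tp l = r -> (0 < l)%N.
  by move=> lm lr; rewrite lt0n; apply: contra xr => /eqP l0; rewrite x0 -l0 lr.
have g0 := pos g gm gr; have g'0 := pos g' g'm g'r.
have ne i j w w' : (0 < i)%N -> (0 < j)%N -> (i < m)%N -> (j < m)%N -> i != j ->
    f (tp i) = f x -> f (tp j) = f x ->
    w != r -> w' != r -> ix w = i -> ix w' = j -> f w = f w'.
  move=> i0 j0 im jm ij ti tj wr w'r wi w'j; case: (ltngtP i j) => h.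
  - exact: (tied_children xr fxr i0 h jm ti tj wr w'r wi w'j).
  - by apply: esym; exact: (tied_children xr fxr j0 h im tj ti w'r wr w'j wi).
  - by rewrite h eqxx in ij.
have [wg wgr wgi] := rt_has_child gm; have [wg' wg'r wg'i] := rt_has_child g'm.
have fg : f (tp g) = f x by rewrite gr fxr.
have fg' : f (tp g') = f x by rewrite g'r fxr.
have gg' : g != g' by rewrite neq_ltn gg.
(* [tied_children] compares different edges only, so two children of edge [g] are compared through
   [g']. *)
have all_ i w : (0 < i)%N -> (i < m)%N -> f (tp i) = f x -> w != r -> ix w = i -> f w = f wg.
  move=> i0 im ti wr wi; have [ig|ig] := eqVneq i g.
    have <- := ne g' g wg' wg g'0 g0 g'm gm _ fg' fg wg'r wgr wg'i wgi; last by rewrite eq_sym.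
    by apply: (ne i g') => //; rewrite ig.
  exact: (ne i g).
have fvw := all_ _ v v0 vm fvx vr erefl.
have xm := rt_ix rt xr.
have x0' : (0 < ix x)%N.
  by rewrite lt0n; apply: contraTneq (rt_neq_top rt xr) => h; rewrite negbK h x0.
(* Since [x] is itself a child of an edge other than 0, the children of the tied edges, and [v]
   among them, attain the maximal value, against f v < f u. *)
have fxw : f x <= f wg.
  have [ltx|lex] := ltnP g (ix x); first by apply: child_ge => //; rewrite wgi.
  rewrite (all_ (ix x) x) //; apply/eqP; rewrite eq_le fxr fmax /=.
  by rewrite -{1}gr; apply: top_mono.
by move: fvu; rewrite fvw ltNge (le_trans (fmax u)) // -fxr.
Qed.

(** By [child_ge] the edge of [u] does not come after that of [v]. If different tops were tied, the
    children would be tied too, unless the edge of [u] is edge 0; its top is then the root. *)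
Lemma parent_values_mono u v : u != r -> v != r -> f v < f u ->
  [\/ tp (ix u) = tp (ix v), f (tp (ix v)) < f (tp (ix u)) /\ tp (ix v) != r
    | tp (ix u) = r].
Proof.
move=> ur vr fvu; have um := rt_ix rt ur; have vm := rt_ix rt vr.
case: (ltngtP (ix u) (ix v)) => uv.
- have := top_mono (ltnW uv) vm; rewrite le_eqVlt => /predU1P[|flt]; last first.
    by constructor 2; split=> //; apply: contraTneq flt => ->; rewrite -leNgt fmax.
  move=> fe; have [->|xy] := eqVneq (tp (ix u)) (tp (ix v)); first by constructor 1.
  have [u0|u0] := posnP (ix u).
    by constructor 3; apply: (root_first_edge (x := tp (ix u)) u0 ur vr) => //; rewrite -?u0.
  by have := tied_children xy (esym fe) u0 uv vm erefl fe ur vr erefl erefl => h; rewrite h ltxx in fvu.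
- by have := child_ge vr ur uv; rewrite leNgt fvu.
- by constructor 1; rewrite uv.
Qed.

Local Notation bef := (before r tp ix f).

Lemma before_stable n n' u v : (height r u < n)%N -> (height r v < n)%N ->
  (height r u < n')%N -> (height r v < n')%N -> bef n u v = bef n' u v.
Proof.
elim: n n' u v => // n IH [//|n'] u v /=; rewrite !ltnS => un vn un' vn'.
have [//|vr] := eqVneq v r; have [//|ur] := eqVneq u r.
rewrite /= (IH n') //; by rewrite -ltnS -hE.
Qed.

Definition precedes : rel G := bef (\max_v height r v).+1.

Lemma height_bound v : (height r v < (\max_w height r w).+1)%N.
Proof. by rewrite ltnS leq_bigmax. Qed.

Lemma precedesE u v : precedes u v = (v != r) && [|| u == r, f v < f u | (f u == f v) &&
  (precedes (tp (ix u)) (tp (ix v)) ||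
   (tp (ix u) == tp (ix v)) && ((ix u < ix v)%N ||
         (ix u == ix v) && (enum_rank u < enum_rank v)%N))].
Proof.
rewrite {1}/precedes /=; have [//|vr] := eqVneq v r; have [//|ur] := eqVneq u r.
have hb x : x != r -> (height r (tp (ix x)) < \max_w height r w)%N.
  by move=> xr; rewrite -ltnS -hE // height_bound.
rewrite /precedes (before_stable (n' := (\max_w height r w).+1)) ?hb ?height_bound //.
Qed.

Lemma precedes_root u : precedes u r = false.
Proof. by rewrite precedesE eqxx. Qed.

Lemma root_precedes v : v != r -> precedes r v.
Proof. by move=> vr; rewrite precedesE vr eqxx. Qed.

Lemma precedes_irr u : precedes u u = false.
Proof.
have [n] := ubnP (height r u); elim: n u => // n IH u; rewrite ltnS => un.
rewrite precedesE; have [//|ur] := eqVneq u r.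
by rewrite ltxx !eqxx !ltnn /= orbF IH // -hE.
Qed.

Lemma precedes_total u v : u != v -> precedes u v || precedes v u.
Proof.
have [n] := ubnP (height r u); elim: n u v => // n IH u v; rewrite ltnS => un uv.
have [ur|ur] := eqVneq u r; first by rewrite ur root_precedes // -ur eq_sym.
have [vr|vr] := eqVneq v r; first by rewrite vr root_precedes ?orbT // -vr.
rewrite precedesE [precedes v u]precedesE ur vr (negPf ur) (negPf vr) /=.
case: (ltgtP (f u) (f v)) => //= _.
have [pp|pp] := eqVneq (tp (ix u)) (tp (ix v)).
  case: (ltngtP (ix u) (ix v)) => iuv; rewrite ?orbT //=.
  have : enum_rank u != enum_rank v :> nat by apply: contra uv => /eqP/ord_inj/enum_rank_inj->.
  by rewrite neq_ltn => /orP[->|->]; rewrite !orbT.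
have := IH (tp (ix u)) (tp (ix v)) _ pp; rewrite -hE // => /(_ un).
by case/orP=> ->; rewrite ?orbT.
Qed.

Lemma precedes_trans : transitive precedes.
Proof.
move=> v u w; have [n] := ubnP (height r u); elim: n u v w => // n IH u v w; rewrite ltnS => un.
have [->|ur] := eqVneq u r.
  by move=> _; rewrite precedesE => /andP[wr _]; exact: root_precedes.
rewrite precedesE (negPf ur) => /andP[vr /= h1].
rewrite precedesE (negPf vr) => /andP[wr /= h2].
rewrite precedesE (negPf ur) wr /=.
case/orP: h1 h2 => [h1|/andP[/eqP fuv h1]] /orP[h2|/andP[/eqP fvw h2]].
- by rewrite (lt_trans h2 h1).
- by rewrite -fvw h1.
- by rewrite fuv h2.
rewrite fuv fvw eqxx ltxx /=.
case/orP: h1 h2 => [h1|/andP[/eqP puv h1]] /orP[h2|/andP[/eqP pvw h2]].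
- by rewrite (IH _ _ _ _ h1 h2) // -hE.
- by rewrite -pvw h1.
- by rewrite puv h2.
rewrite puv pvw eqxx /=; apply/orP; right.
case/orP: h1 h2 => [h1|/andP[/eqP iuv h1]] /orP[h2|/andP[/eqP ivw h2]].
- by rewrite (ltn_trans h1 h2).
- by rewrite -ivw h1.
- by rewrite iuv h2.
- by rewrite iuv ivw eqxx (ltn_trans h1 h2) orbT.
Qed.

Lemma precedes_lt u v : u != r -> f v < f u -> v != r -> precedes u v.
Proof. by move=> ur fvu vr; rewrite precedesE fvu vr orbT. Qed.

(** This compatibility with parents is the source of (S1), (S2) and (S4). *)
Lemma precedes_parent u v : u != r -> v != r -> precedes u v ->
  tp (ix u) = tp (ix v) \/ precedes (tp (ix u)) (tp (ix v)).
Proof.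
move=> ur vr; rewrite precedesE vr (negPf ur) /=.
case/orP=> [fvu|/andP[_ /orP[|/andP[/eqP->]]]]; [|by right|by left].
have [|[plt pr]|pr] := parent_values_mono ur vr fvu; first by left.
  have [->|pur] := eqVneq (tp (ix u)) r; first by right; exact: root_precedes.
  by right; exact: precedes_lt.
have [pvr|pvr] := eqVneq (tp (ix v)) r; first by left; rewrite pr pvr.
by right; rewrite pr root_precedes.
Qed.

Lemma precedes_height u v : precedes u v -> (height r u <= height r v)%N.
Proof.
have [n] := ubnP (height r v); elim: n u v => // n IH u v; rewrite ltnS => vn puv.
have [->|ur] := eqVneq u r; first by rewrite h0.
have vr : v != r by apply: contraTneq puv => ->; rewrite precedes_root.
rewrite (hE ur) (hE vr) ltnS; have [->//|] := precedes_parent ur vr puv.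
by apply: IH; rewrite -hE.
Qed.

Lemma precedes_value u v : precedes u v -> f v <= f u.
Proof.
rewrite precedesE => /andP[_ /or3P[/eqP->|/ltW//|/andP[/eqP-> _]//]].
exact: fmax.
Qed.

Lemma parentP u v : is_parent r u v -> v != r /\ u = tp (ix v).
Proof.
move=> /andP[auv /eqP hv]; have vr : v != r by apply: contra_eqN hv => /eqP->; rewrite h0.
split=> //; have uv : u != v by apply: contra_eqN hv => /eqP->; rewrite neq_ltn ltnSn.
have vu : v != u by rewrite eq_sym.
have [j jm /and3P[vj uj _]] := rt_adjE rt vu auv.
move: uj vj; rewrite !(rt_mem rt) //.
case/predU1P=> [uj|/andP[ur /eqP uj]].
  case/predU1P=> [vj|/andP[_ /eqP->//]]; by rewrite uj vj eqxx in uv.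
case/predU1P=> [vj|/andP[_ /eqP vj]].
  by move: (hE ur) hv; rewrite uj -vj; clear; lia.
by move: hv; rewrite (hE ur) (hE vr) uj vj; clear; lia.
Qed.

Lemma precedes_SLO : SLO_ordering K.+1 r precedes.
Proof.
split; first by split; [exact: precedes_irr|exact: precedes_trans|exact: precedes_total].
split.
- exact: precedes_height.
- move=> u v u1 v1 /parentP[u1r ->] /parentP[v1r ->] puv.
  have ne : u1 != v1 by apply: contraTneq puv => ->; rewrite precedes_irr.
  case/orP: (precedes_total ne) => // pvu.
  have [e|h] := precedes_parent v1r u1r pvu; first by rewrite e precedes_irr in puv.
  by have := precedes_trans puv h; rewrite precedes_irr.
- move=> u v puv ub; apply/negPn/negP => vb.
  have vI : v \in interior_vertices G by rewrite inE.
  by have := precedes_value puv; rewrite (fb ub) leNgt interior_gt0.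
- move=> e x eE eX xmono i j i1 ij [v [ve piv pvj]].
  have /(rt_edges rt)[l lm El] := eE.
  have xe a : x a \in E l by rewrite -El eX imset_f.
  (* The top of [e] has smaller height than the other vertices, so it is [x ord0]. *)
  have nontop (a : 'I_K.+1) : (1 <= a)%N -> x a != r /\ ix (x a) = l.
    move=> a1; have p0 : precedes (x ord0) (x a) by apply: xmono.
    have ne : x ord0 != x a by apply: contraTneq p0 => ->; rewrite precedes_irr.
    have := xe a; rewrite (rt_mem rt) // => /orP[/eqP xa|/andP[-> /eqP->] //].
    have := xe ord0; rewrite (rt_mem rt) // -xa (negPf ne) /= => /andP[x0r /eqP x0l].
    by have := precedes_height p0; rewrite (hE x0r) x0l -xa ltnn.
  have [ir il] := nontop i i1; have [jr jl] : x j != r /\ ix (x j) = l by apply: nontop; rewrite ij.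
  have vr : v != r by apply: contraTneq piv => ->; rewrite precedes_root.
  have vl : ix v != l.
    by apply: contraNneq ve => vl; rewrite El (rt_mem rt) // vr vl eqxx orbT.
  (* Squeezed between children of [tp l], the vertex [v] has the same parent. As its edge is not
     [l], values and edge indices both put it on one side of all children of edge [l]. *)
  have pv : tp (ix v) = tp l.
    have [h1|h1] := precedes_parent ir vr piv; first by rewrite -h1 il.
    have [h2|h2] := precedes_parent vr jr pvj; first by rewrite h2 jl.
    by have := precedes_trans h1 h2; rewrite il jl precedes_irr.
  have [fiv fvj] := (precedes_value piv, precedes_value pvj).
  case: (ltngtP (ix v) l) => lv; last by case/eqP: vl.
    have le : f (x i) <= f v by apply: child_ge => //; rewrite il.
    move: piv; rewrite precedesE vr (negPf ir) ltNge le /= il pv precedes_irr eqxx.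
    by rewrite ltnNge (ltnW lv) /= [l == _]eq_sym (negPf vl) andbF.
  have le : f v <= f (x j) by apply: child_ge => //; rewrite jl.
  move: pvj; rewrite precedesE jr (negPf vr) ltNge le /= jl pv precedes_irr eqxx.
  by rewrite (negPf vl) ltnNge (ltnW lv) /= andbF.
- move=> u v uI vI puv; have uv : u != v by apply: contraTneq puv => ->; rewrite precedes_irr.
  have [h|[z zI h]] := interior_degrees; first by rewrite !h.
  have [uz|uz] := eqVneq u z; last by rewrite (h u uI uz).1; exact: dI.
  have vz : v != z by rewrite -uz eq_sym.
  by have := precedes_value puv; rewrite uz leNgt (h v vI vz).2.
Qed.

Lemma one_big_degree : (#|[set v in interior_vertices G | (D.+1 < deg v)%N]| <= 1)%N.
Proof.
have [h|[z zI h]] := interior_degrees.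
  rewrite (eq_card0) // => v; rewrite inE; apply/negP => /andP[vI].
  by rewrite h // ltnn.
apply: leq_trans (_ : #|[set z]| <= 1)%N; last by rewrite cards1.
apply: subset_leq_card; apply/subsetP => v; rewrite finset.inE => /andP[vI dv]; rewrite finset.inE.
by apply/negPn/negP => vz; move: dv; rewrite (h v vI vz).1 ltnn.
Qed.

End Order.

Local Close Scope ring_scope.

(** * SLO-supertrees are breadth-first trees *)

Section Isomorphism.
Implicit Types G H : hypergraph.

Lemma isomorphic_sym G H : isomorphic G H -> isomorphic H G.
Proof.
case=> f [[g fK gK] fE]; exists g; split; first exact: (Bijective gK fK).
by move=> e; rewrite fE -imset_comp (@eq_imset _ _ (f \o g) id) ?imset_id.
Qed.

Lemma isomorphic_trans H G L : isomorphic G H -> isomorphic H L -> isomorphic G L.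
Proof.
case=> f [fB fE] [g [gB gE]]; exists (g \o f); split; first exact: bij_comp.
by move=> e; rewrite fE gE -imset_comp.
Qed.

Section Invariance.
Variables (G H : hypergraph) (f : G -> H).
Hypothesis fB : bijective f.
Hypothesis fE : forall e : {set G}, (e \in edges G) = ((f @: e)%SET \in edges H).
Let fI : injective f := bij_inj fB.

Lemma iso_preimset (e : {set H}) : exists e' : {set G}, (e = f @: e')%SET.
Proof.
case: fB => g fK gK; exists (g @: e)%SET; rewrite -imset_comp.
by rewrite (@eq_imset _ _ (f \o g) id) ?imset_id.
Qed.

Lemma iso_adj u v : adj (f u) (f v) = adj u v.
Proof.
rewrite /adj (inj_eq fI); congr (_ && _); apply/existsP/existsP => -[e].
  have [e' ->] := iso_preimset e; rewrite -fE !(mem_imset _ _ fI) => h.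
  by exists e'.
by move=> h; exists (f @: e)%SET; rewrite -fE !(mem_imset _ _ fI).
Qed.

Lemma iso_deg v : deg (f v) = deg v.
Proof.
rewrite /deg -(card_imset _ (imset_inj fI)); apply: eq_card => e; rewrite inE.
have [e' ->] := iso_preimset e; rewrite (mem_imset _ _ (imset_inj fI)) inE.
by rewrite -fE (mem_imset _ _ fI).
Qed.

Local Open Scope ring_scope.
Lemma iso_rayleigh (R : realType) k (g : H -> R) : rayleigh k (g \o f) = rayleigh k g.
Proof.
rewrite /rayleigh; congr (_ * _ / _).
  rewrite [RHS](reindex f) /=; last exact: onW_bij.
  apply: eq_bigr => u _; rewrite [RHS](reindex f) /=; last exact: onW_bij.
  by apply: eq_bigl => v; rewrite iso_adj.
by rewrite [RHS](reindex f) //=; exact: onW_bij.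
Qed.

End Invariance.

Lemma iso_first_eigenvalue_le (R : realType) k G H :
  isomorphic G H -> interior_vertices H != finset.set0 ->
  (first_eigenvalue G R k <= first_eigenvalue H R k)%R.
Proof.
move=> [f [fB fE]] /(first_eigenvalue_min R k)[g [[[w gw] gb] -> _]].
rewrite -(iso_rayleigh fB fE); apply: first_eigenvalue_le; split.
  by case: fB => f' _ f'K; exists (f' w); rewrite /= f'K.
move=> v; rewrite inE => vb; apply: gb.
by rewrite inE (iso_deg fB fE).
Qed.

End Isomorphism.

(** * Numbering the vertices along an SLO-ordering *)

Section SLO.
Variables (G : hypergraph) (K D n n0 : nat).
Hypotheses (K0 : 0 < K) (D0 : 0 < D) (n00 : 0 < n0).
Hypothesis GC : supertree_class K.+1 D.+1 n n0 G.
Variables (r : G) (lt : rel G).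
Hypothesis ltP : SLO_ordering K.+1 r lt.
Hypothesis bigdeg : #|[set v in interior_vertices G | D.+1 < deg v]| <= 1.

Let stG : supertree G. Proof. by have [[]] := GC. Qed.
Let uG : k_uniform G K.+1. Proof. by have [[]] := GC. Qed.
Let cI : #|interior_vertices G| = n0. Proof. by have [] := GC. Qed.
Let dI v : v \in interior_vertices G -> D < deg v. Proof. by have [_ _ _ h] := GC; exact: h. Qed.
Let irr u : lt u u = false. Proof. by have [[]] := ltP. Qed.
Let tr : transitive lt. Proof. by have [[]] := ltP. Qed.
Let tot u v : u != v -> lt u v || lt v u. Proof. by have [[_ _ h] _] := ltP; exact: h. Qed.
Let anti u v : lt u v -> lt v u = false.
Proof. by move=> uv; apply/negP => vu; have := tr uv vu; rewrite irr. Qed.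

Variables (top : {set G} -> G) (up : G -> {set G}).
Hypothesis upE : forall v, v != r -> up v \in edges G /\ v \in up v.
Hypothesis hE : forall v, v != r -> height r v = (height r (top (up v))).+1.
Hypothesis h0 : height r r = 0.
Hypothesis rtE : forall es, perm_eq es (enum (edges G)) ->
  rooting r (size es) (nth finset.set0 es) (fun j => top (nth finset.set0 es j))
    (fun v => index (up v) es) (height r).

Lemma SLO_root v : v != r -> lt r v.
Proof.
move=> vr; have /orP[h|//] := tot vr.
by have [_ [S1 _ _ _ _]] := ltP; have := S1 _ _ h; rewrite h0 (hE vr).
Qed.

Lemma SLO_root_interior : r \in interior_vertices G.
Proof.
have [_ [_ _ S3 _ _]] := ltP.
have [w wI] : exists w, w \in interior_vertices G by apply/card_gt0P; rewrite cI.
have [<-//|wr] := eqVneq w r; rewrite inE; apply/negP => rb.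
by move: wI; rewrite inE (S3 _ _ (SLO_root wr) rb).
Qed.

Let le u v := (u == v) || lt u v.
Let le_total : total le.
Proof.
move=> u v; rewrite /le; have [->//|uv] := eqVneq u v.
exact: tot.
Qed.
Let le_trans : transitive le.
Proof.
move=> v u w /predU1P[->//|uv] /predU1P[<-|vw]; rewrite /le ?uv ?orbT //.
by rewrite (tr uv vw) orbT.
Qed.

Lemma SLO_sort (e : {set G}) : e \in edges G -> exists x : 'I_K.+1 -> G,
  (e = [set x i | i : 'I_K.+1])%SET /\ (forall i j : 'I_K.+1, i < j -> lt (x i) (x j)).
Proof.
move=> eE; pose t := sort le (enum e).
have st : size t = K.+1 by rewrite size_sort -cardE uG.
have ut : uniq t by rewrite sort_uniq enum_uniq.
exists (fun i => nth r t i); split.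
  apply/setP => v; rewrite -mem_enum -(mem_sort le) -/t; apply/idP/imsetP.
    move=> vt; have it : index v t < K.+1 by rewrite -st index_mem.
    by exists (Ordinal it); rewrite //= nth_index.
  by case=> i _ ->; rewrite mem_nth // st.
move=> i j ij; have it : i < size t by rewrite st.
have jt : j < size t by rewrite st.
have := sorted_ltn_nth le_trans r (sort_sorted le_total (enum e)) i j it jt ij.
by case/predU1P => // /eqP; rewrite nth_uniq // eqn_leq [j <= i]leqNgt ij andbF.
Qed.

(** (S4) speaks of neighbouring vertices of an edge only; with i the largest index such that x_i
    precedes [w], the vertex [w] falls between x_i and x_(i+1). *)
Lemma SLO_contiguous a b w : a != r -> b != r -> up a = up b ->
  w != r -> up w != up a -> lt a w -> lt w b -> False.
Proof.
have [_ [S1 _ _ S4 _]] := ltP.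
move=> ar br ab wr wa aw wb; have [eE ae] := upE ar.
have be : b \in up a by have [_] := upE br; rewrite ab.
set e := up a in ab wa eE ae be.
have rt := rtE (perm_refl _).
have inE' v : (v \in e) = (v == top e) || (v != r) && (up v == e).
  have im : index e (enum (edges G)) < size (enum (edges G)) by rewrite index_mem mem_enum.
  have := rt_mem rt v im; rewrite nth_index ?mem_enum // => ->.
  congr (_ || _); have [//|vr] := eqVneq v r; have [uvE _] := upE vr.
  apply/eqP/eqP => [h|->//]; apply: (@index_inj _ finset.set0 (enum (edges G))) h.
    by rewrite mem_enum.
  by rewrite mem_enum.
have topa v : v != r -> up v = e -> lt v (top e) = false.
  move=> vr ve; apply/negP => /S1; rewrite (hE vr) ve.
  by rewrite ltnn.
have we : w \notin e.
  rewrite inE' negb_or wr (negPf wa) andbT; apply/negP => /eqP wt.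
  by move: aw; rewrite wt topa.
have [x [eX xmono]] := SLO_sort eE.
have [p ap] : exists p, x p = a.
  by move: ae; rewrite eX => /imsetP[p _ ->]; exists p.
have [q bq] : exists q, x q = b.
  by move: be; rewrite eX => /imsetP[q _ ->]; exists q.
have p1 : 1 <= p.
  rewrite lt0n; apply/eqP => p0.
  have te : top e \in e by rewrite inE' eqxx.
  move: te; rewrite {2}eX => /imsetP[t _ tE].
  have t0 : p < t.
    rewrite p0 lt0n; apply/eqP => t0; have tp_ : t = p by apply: ord_inj; rewrite t0.
    have at_ : a = top e by rewrite tE tp_.
    by have := hE ar; rewrite -/e -at_ => /eqP; rewrite eqn_leq ltnn andbF.
  by have := xmono _ _ t0; rewrite ap -tE topa.
pose P (i : nat) := (i < K.+1) && lt (x (inord i)) w.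
have exP : exists i, P i by exists p; rewrite /P ltn_ord inord_val ap.
have bP i : P i -> i <= K by case/andP.
case: (ex_maxnP exP bP) => i /andP[iK ltiw] imax.
have pi : p <= i by apply: imax; rewrite /P ltn_ord inord_val ap.
have iq : i < q.
  rewrite ltnNge; apply/negP; rewrite leq_eqVlt => /predU1P[qi|qi].
    by move: ltiw; rewrite -qi inord_val bq => /(tr wb); rewrite irr.
  have := xmono q (inord i); rewrite inordK // => /(_ qi); rewrite bq => h.
  by have := tr (tr wb h) ltiw; rewrite irr.
have i1K : i.+1 < K.+1 by apply: leq_ltn_trans iq (ltn_ord q).
apply: (S4 e x eE eX xmono (inord i) (inord i.+1)); rewrite ?inordK //.
  exact: leq_trans pi.
exists w; split=> //; have wx : w != x (inord i.+1).
  by apply: contraNneq we => ->; rewrite eX imset_f.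
have /orP[//|h] := tot wx.
by have := imax i.+1; rewrite /P i1K h ltnn => /(_ isT).
Qed.

Lemma has_first_child e : exists v, e \in edges G -> v != r /\ up v = e.
Proof.
have [eE|neE] := boolP (e \in edges G); last by exists r.
have rt := rtE (perm_refl _); pose j := index e (enum (edges G)).
have jm : j < size (enum (edges G)) by rewrite index_mem mem_enum.
have [v vr vj] := rt_has_child rt uG K0 jm; exists v => _; split=> //.
apply: (@index_inj _ finset.set0 (enum (edges G))) vj; rewrite mem_enum //.
by case: (upE vr).
Qed.

(** Sort the edges by one chosen child of each; by contiguity every other choice of children gives
    the same order. *)
Lemma SLO_enumeration : exists es, perm_eq es (enum (edges G)) /\
  forall u v, u != r -> v != r -> index (up u) es < index (up v) es -> lt u v.
Proof.
have [c cP] := choice has_first_child.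
pose leE e e' := le (c e) (c e').
have leE_total : total leE by move=> e e'; exact: le_total.
have leE_trans : transitive leE by move=> e2 e1 e3; exact: le_trans.
exists (sort leE (enum (edges G))); split; first by rewrite perm_sort.
set es := sort _ _; move=> u v ur vr uv.
have mes e : (e \in es) = (e \in edges G) by rewrite mem_sort mem_enum.
have [uE _] := upE ur; have [vE _] := upE vr.
have [cur cu] := cP _ uE; have [cvr cv] := cP _ vE.
have iu : index (up u) es < size es by rewrite index_mem mes.
have iv : index (up v) es < size es by rewrite index_mem mes.
have ne : up u != up v by apply: contraTneq uv => ->; rewrite ltnn.
have cuv : lt (c (up u)) (c (up v)).
  have := sorted_ltn_nth leE_trans finset.set0 (sort_sorted leE_total (enum (edges G))) _ _ iu iv uv.
  rewrite !nth_index ?mes // => /predU1P[h|//].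
  by move: ne; rewrite -cu h cv eqxx.
have uv' : u != v by apply: contraNneq ne => ->.
have /orP[//|vu] := tot uv'; exfalso.
have [e|cvu] := eqVneq (c (up v)) u; first by move: ne; rewrite -cv e eqxx.
have /orP[h|h] := tot cvu.
  by apply: (@SLO_contiguous (c (up u)) u (c (up v))); rewrite ?cu ?cv // eq_sym.
by apply: (@SLO_contiguous v (c (up v)) u); rewrite ?cu ?cv.
Qed.

Definition slo_rank v := #|[pred w | lt w v]|.

Lemma slo_rank_lt u v : lt u v -> slo_rank u < slo_rank v.
Proof.
move=> uv; apply: proper_card; apply/properP; split.
  by apply/subsetP => w; rewrite !inE => wu; exact: tr wu uv.
by exists u; rewrite !inE ?irr.
Qed.

Lemma slo_rank_inj : injective slo_rank.
Proof.
move=> u v uv; apply/eqP/negPn/negP => /tot /orP[] /slo_rank_lt; by rewrite uv ltnn.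
Qed.

Section Numbering.
Variables (m : nat) (E : nat -> {set G}) (tp : nat -> G) (ix : G -> nat).
Hypothesis rt : rooting r m E tp ix (height r).
Hypothesis hix : forall v, v != r -> height r v = (height r (tp (ix v))).+1.
Hypothesis ixlt : forall u v, u != r -> v != r -> ix u < ix v -> lt u v.

Lemma slo_rank_root : slo_rank r = 0.
Proof.
apply: eq_card0 => w; rewrite inE; have [->|wr] := eqVneq w r; first exact: irr.
exact: anti (SLO_root wr).
Qed.

(** Before [v] come the root, the K children of each earlier edge, and fewer than K siblings from
    its own edge. *)
Lemma slo_rank_child v : v != r -> slo_rank v != 0 /\ (slo_rank v).-1 %/ K = ix v.
Proof.
move=> vr; have vm := rt_ix rt vr.
have e1 : slo_rank v = (ix v * K + \sum_(w | (w != r) && (ix w == ix v)) lt w v).+1.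
  rewrite /slo_rank -sum1_card big_mkcond /=.
  rewrite (eq_bigr (fun w => nat_of_bool (lt w v))); last by move=> w _; rewrite inE; case: (lt _ _).
  rewrite (rt_big rt) /= SLO_root // add1n; congr _.+1.
  rewrite (bigD1 (Ordinal vm)) //= addnC; congr (_ + _).
  rewrite (eq_bigr (fun j : 'I_m => if j < ix v then K else 0)); last first.
    move=> j jv; case: ltnP => jlt.
      rewrite -[RHS](rt_card_children rt uG (ltn_ord j)); apply: eq_bigr => w /andP[wr /eqP wj].
      by rewrite (ixlt wr vr) // wj.
    rewrite big1 // => w /andP[wr /eqP wj].
    rewrite anti // ixlt // wj ltn_neqAle jlt andbT eq_sym.
    by move: jv; rewrite -(inj_eq val_inj).
  rewrite -big_mkcondr /= (eq_bigl (fun j : 'I_m => j < ix v)); last first.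
    move=> j; rewrite -(inj_eq val_inj) /= andbC; case: ltnP => // h.
    by rewrite neq_ltn h.
  by rewrite -(big_ord_widen m (fun=> K) (ltnW vm)) sum_nat_const card_ord.
split; first by rewrite e1.
rewrite e1 /= divnMDl // divn_small ?addn0 //.
rewrite -[ltnRHS](rt_card_children rt uG vm).
rewrite (bigD1 v) ?vr ?eqxx //= irr add0n [ltnRHS](bigD1 v) ?vr ?eqxx //= add1n ltnS.
by apply: leq_sum => w _; case: (lt _ _).
Qed.

Lemma SLO_parent_mono i j : i <= j -> j < m -> lt (tp j) (tp i) = false.
Proof.
move=> ij jm; apply/negP => ji; have im := leq_ltn_trans ij jm.
have [_ [_ S2 _ _ _]] := ltP.
have [u ur ui] := rt_has_child rt uG K0 im; have [v vr vj] := rt_has_child rt uG K0 jm.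
have par w : w != r -> is_parent r (tp (ix w)) w.
  move=> wr; have wm := rt_ix rt wr; rewrite /is_parent hix // eqxx andbT.
  rewrite /adj (rt_neq_top rt) //=; apply/existsP; exists (E (ix w)).
  by rewrite (rt_edge rt) // (rt_top rt) // (rt_child rt).
have := S2 _ _ _ _ (par _ vr) (par _ ur); rewrite ui vj => /(_ ji) vu.
move: ij; rewrite leq_eqVlt => /predU1P[e|ij]; first by move: ji; rewrite e irr.
by have := ixlt ur vr; rewrite ui vj => /(_ ij) /anti; rewrite vu.
Qed.

(** By (S5) a larger degree at [u] would recur at [v], against [bigdeg]. *)
Lemma SLO_deg_before u v : u \in interior_vertices G -> v \in interior_vertices G ->
  lt u v -> deg u = D.+1.
Proof.
have [_ [_ _ _ _ S5]] := ltP.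
move=> uI vI uv; have uv_le := S5 _ _ uI vI uv.
apply/eqP; rewrite eqn_leq dI // andbT leqNgt; apply/negP => du.
have : 1 < #|[set v in interior_vertices G | D.+1 < deg v]|.
  apply/card_gt1P; exists u, v; rewrite !inE in uI vI *.
  rewrite uI vI du (leq_trans du uv_le); split=> //.
  by apply: contraTneq uv => ->; rewrite irr.
by rewrite ltnNge bigdeg.
Qed.

Lemma slo_rank_interior v : v \in interior_vertices G -> slo_rank v < n0.
Proof.
have [_ [_ _ S3 _ _]] := ltP.
move=> vI; rewrite -cI; apply: proper_card; apply/properP; split; last by exists v => //; rewrite inE irr.
apply/subsetP => w; rewrite inE => wv; rewrite inE; apply/negP => wb.
by move: vI; rewrite inE (S3 _ _ wv wb).
Qed.

Lemma SLO_deg_rank v : v \in interior_vertices G -> slo_rank v < n0.-1 -> deg v = D.+1.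
Proof.
move=> vI vn; apply/eqP/negPn/negP => dv.
have sub : interior_vertices G \subset [predU1 v & [pred w | lt w v]].
  apply/subsetP => w wI; rewrite !inE; have [//|wv] := eqVneq w v.
  have /orP[->//|vw] := tot wv.
  by move: dv; rewrite (SLO_deg_before vI wI vw) eqxx.
have := subset_leq_card sub; rewrite cI cardU1 inE /= irr add1n -/(slo_rank v).
by move: vn; clear -n00; lia.
Qed.

(** Tops are sorted, so [j] is at least the number S of edges topped by predecessors of T and less
    than S plus the number topped by T. For T other than the root, [rt_count] gives S = rank(T) D +
    1, and T tops [D] edges unless it is the last interior vertex. The root has S = 0 and is treated
    apart. *)
Lemma slo_rank_top j : j < m -> slo_rank (tp j) = bfs_parent D n0 j.
Proof.
move=> jm; set T := tp j.
have TI : T \in interior_vertices G by apply: (rt_top_interior rt) => //; exact: SLO_root_interior.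
have Tn := slo_rank_interior TI.
have jE : j = \sum_(i < m) (i < j).
  rewrite -[LHS]card_ord -sum1_card (big_ord_widen m (fun=> 1) (ltnW jm)) big_mkcond.
  by apply: eq_bigr => i _; case: ltnP.
have j1E : j.+1 = \sum_(i < m) (i < j.+1).
  rewrite -[LHS]card_ord -sum1_card (big_ord_widen m (fun=> 1) jm) big_mkcond.
  by apply: eq_bigr => i _; case: ltnP.
have lo : \sum_(i < m) lt (tp i) T <= j.
  rewrite [leqRHS]jE; apply: leq_sum => i _; case: ltnP => [_|ji]; first exact: leq_b1.
  by rewrite SLO_parent_mono.
have hi : j < \sum_(i < m) lt (tp i) T + \sum_(i < m) (tp i == T).
  rewrite -big_split /= [leqLHS]j1E; apply: leq_sum => i _; case: ltnP => //.
  rewrite ltnS => ij; have [->|iT] := eqVneq (tp i) T; first by rewrite addn1.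
  by have /orP[->//|h] := tot iT; rewrite SLO_parent_mono in h.
have dT := rt_deg rt T.
have [Tr|Tr] := eqVneq T r.
  rewrite Tr slo_rank_root in hi lo dT Tn *; rewrite /bfs_parent.
  rewrite [X in _ < X + _]big1 ?add0n in hi; last first.
    move=> i _; have [->|ir] := eqVneq (tp i) r; first by rewrite irr.
    by rewrite anti // SLO_root.
  rewrite eqxx addn0 in dT; rewrite -dT in hi.
  have [->|n01] := eqVneq n0 1; first by rewrite min0n.
  have := @SLO_deg_rank r; rewrite slo_rank_root SLO_root_interior => /(_ isT) dr.
  rewrite dr in hi; last by move: n01 n00; clear; lia.
  rewrite divn_small ?minn0 //.
  by case: (j) hi => //= i; rewrite ltnS.
have PI w : lt w T -> deg w = D.+1.
  move=> wT; apply: (SLO_deg_before _ TI wT); have [_ [_ _ S3 _ _]] := ltP.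
  by rewrite inE; apply/negP => wb; move: TI; rewrite inE (S3 _ _ wT wb).
have := rt_count rt (SLO_root Tr : (fun w => lt w T) r).
rewrite -/(slo_rank T) (eq_bigr (fun=> D.+1)) => [|w /PI //].
rewrite sum_nat_const -[#|_|]/(slo_rank T) => cT.
rewrite Tr in dT.
set S := \sum_(i < m) lt (tp i) T in lo hi cT; set S' := \sum_(i < m) _ in hi dT.
have SE : S = (slo_rank T * D).+1 by move: cT; clear; nia.
have ge : slo_rank T <= j.-1 %/ D by rewrite leq_divRL //; move: lo; rewrite SE; clear; lia.
have [Te|Te] := eqVneq (slo_rank T) n0.-1; first by rewrite /bfs_parent Te in ge *; move: ge; clear; lia.
have Tn' : slo_rank T < n0.-1 by move: Tn Te; clear; lia.
have := SLO_deg_rank TI Tn'; rewrite dT => dD.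
have lt1 : j.-1 %/ D < (slo_rank T).+1.
  by rewrite ltn_divLR // mulSn; move: lo hi dD; rewrite SE; clear; lia.
by rewrite /bfs_parent; move: ge lt1 Tn'; clear; lia.
Qed.

End Numbering.

Lemma SLO_isomorphic : isomorphic G (bfs_tree K D #|edges G| n0).
Proof.
have [es [pes ixlt]] := SLO_enumeration.
have rt := rtE pes; have ses : size es = #|edges G| by rewrite (perm_size pes) -cardE.
set m := #|edges G| in ses *; rewrite ses in rt.
have hix v : v != r -> height r v = (height r (top (nth finset.set0 es (index (up v) es)))).+1.
  move=> vr; rewrite nth_index; first exact: hE.
  by rewrite (perm_mem pes) mem_enum; case: (upE vr).
have cG := rt_card rt uG.
have n0m : n0 * D < m := edge_count SLO_root_interior cI dI rt.
have rC := bfs_tree_rooting K0 D0 n00 n0m.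
have rlt v : slo_rank v < (m * K).+1.
  rewrite -cG; apply: proper_card; apply/properP; split; first exact/subsetP.
  by exists v; rewrite ?inE ?irr.
pose phi v : bfs_tree K D m n0 := inord (slo_rank v).
have phiE v : phi v = slo_rank v :> nat by rewrite inordK.
have phiI : injective phi.
  by move=> u v uv; apply: slo_rank_inj; rewrite -!phiE uv.
have edgeE j : j < m -> (phi @: nth finset.set0 es j)%SET = bfs_edge K D m n0 j.
  (* One inclusion suffices, as both sides have K + 1 elements. *)
  move=> jm; apply/eqP; rewrite eqEcard; apply/andP; split.
    apply/subsetP => _ /imsetP[v vj ->]; rewrite inE phiE.
    move: vj; rewrite (rt_mem rt) // => /predU1P[->|/andP[vr /eqP vj]].
      by rewrite (slo_rank_top rt hix ixlt) // eqxx.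
    have [r0 rd] := slo_rank_child rt ixlt vr.
    by rewrite rd vj eqxx andbT -(inj_eq (@ord_inj _)) phiE r0 orbT.
  rewrite (card_imset _ phiI) (uG (rt_edge rt jm)).
  by rewrite (bfs_tree_uniform K0 D0 n00 n0m (rt_edge rC jm)).
exists phi; split; first by apply: inj_card_bij => //; rewrite card_ord cG.
move=> e; apply/idP/idP.
  case/(rt_edges rt) => j jm ->; rewrite edgeE //; exact: (rt_edge rC).
case/(rt_edges rC) => j jm; rewrite -edgeE // => /(imset_inj phiI) ->.
exact: (rt_edge rt).
Qed.

End SLO.

(** * Characterisation and uniqueness *)

Lemma class_SLO_isomorphic (G : hypergraph) (K D n n0 : nat) :
  0 < K -> 0 < D -> 0 < n0 -> supertree_class K.+1 D.+1 n n0 G ->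
  SLO_supertree G K.+1 -> #|[set v in interior_vertices G | D.+1 < deg v]| <= 1 ->
  isomorphic G (bfs_tree K D #|edges G| n0).
Proof.
move=> K0 D0 n00 GC [stG [r [lt ltP]]] bigdeg; have [[_ uG] _ _ _] := GC.
have [top [up [rtE upE _ hE h0]]] := supertree_rooting r stG uG K0.
exact: (SLO_isomorphic K0 D0 n00 GC ltP bigdeg upE hE h0 rtE).
Qed.

Lemma faber_krahn_SLO (R : realType) (G : hypergraph) (K D n n0 : nat) :
  0 < K -> 0 < D -> 0 < n0 -> faber_krahn R K.+1 (supertree_class K.+1 D.+1 n n0) G ->
  SLO_supertree G K.+1 /\ #|[set v in interior_vertices G | D.+1 < deg v]| <= 1.
Proof.
move=> K0 D0 n00 [GC Gmin]; have [[stG uG] _ cI dI] := GC.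
have [nE n0m] := class_size K0 n00 GC.
have [r [f [s [E [tp [ix [[rt hE] [rI f0 fmax fb sP] sA _ opt]]]]]]] :=
  optimal_comparison R K0 D0 n00 GC.
(* The breadth-first tree lies in the class, so minimality puts [G] in the equality case. *)
have /Gmin/opt[smin topE childE prefix] :
    supertree_class K.+1 D.+1 n n0 (bfs_tree K D #|edges G| n0).
  by rewrite nE; exact: bfs_tree_class.
have [smono s0 _] := sP; have cG := rt_card rt uG.
have sout i : n0 <= i -> i < (#|edges G| * K).+1 -> s i = GRing.zero.
  by move=> ni im; apply: (sorted_value_exterior fb cI sP) => //; rewrite cG.
have s00 : (0%R < s 0)%R.
  have [[i si] _] := sA; apply: Order.POrderTheory.lt_le_trans (smono 0 i (leq0n _)).
  by rewrite Order.POrderTheory.lt_neqAle eq_sym si s0.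
have eig := bfs_tree_eigen_eq K0 D0 n00 n0m sA smin.
have spos := interior_values_gt0 n00 s0 s00 eig.
have tieP := tie_block_sums K0 D0 n00 n0m smono s0 sout s00 eig.
have last_lt := last_value_lt K0 D0 n00 n0m smono s0 sout s00 eig.
have h0 : height r r = 0 by exact: (@height_path G stG r r [::]).
split.
  split=> //; exists r; eexists.
  exact: (precedes_SLO rt hE h0 uG K0 D0 n00 fmax fb rI cI dI sP topE childE prefix spos tieP last_lt).
exact: (one_big_degree rt uG K0 D0 n00 fmax fb rI cI dI sP topE spos last_lt).
Qed.

Theorem theorem2p3 (R : realType) (k d n n0 : nat)
    (hk : 2 <= k) (hd : 2 <= d) (hn0 : 1 <= n0) :
  (forall G : hypergraph, supertree_class k d n n0 G ->
     (faber_krahn R k (supertree_class k d n n0) G <->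
      [/\ SLO_supertree G k,
          #|[set v in interior_vertices G | d < deg v]| <= 1
        & forall v : G, v \in interior_vertices G ->
            deg v = d \/ d < deg v]))
  /\
  (forall G H : hypergraph,
     faber_krahn R k (supertree_class k d n n0) G ->
     faber_krahn R k (supertree_class k d n n0) H ->
     isomorphic G H).
Proof.
case: k hk => [//|K] K0; case: d hd => [//|D] D0.
have edges_eq (G H : hypergraph) : supertree_class K.+1 D.+1 n n0 G ->
    supertree_class K.+1 D.+1 n n0 H -> #|edges G| = #|edges H|.
  move=> GC HC; have [nG _] := class_size K0 hn0 GC; have [nH _] := class_size K0 hn0 HC; apply/eqP.
  by rewrite -(eqn_pmul2r K0) -eqSS -nG -nH.
split=> [G GC|G H GF HF].
  split=> [/(faber_krahn_SLO K0 D0 hn0)[GS Gd]|[GS Gd _]].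
    split=> // v vI; have [_ _ _ /(_ v vI)] := GC.
    by rewrite leq_eqVlt => /predU1P[<-|]; [left|right].
  split=> // H HC; have iso := class_SLO_isomorphic K0 D0 hn0 GC GS Gd.
  (* [G] is isomorphic to the breadth-first tree that bounds [H] from below; equal edge numbers make
     it the same tree for both. *)
  have [r [f [s [E [tp [ix [_ _ _ le _]]]]]]] := optimal_comparison R K0 D0 hn0 HC.
  apply: Order.POrderTheory.le_trans le; rewrite -(edges_eq G H GC HC).
  apply: iso_first_eigenvalue_le => //; have [_ n0m] := class_size K0 hn0 GC.
  have [_ _ cI _] := bfs_tree_class K0 D0 hn0 n0m.
  by rewrite -cards_eq0 cI -lt0n.
have [GS Gd] := faber_krahn_SLO K0 D0 hn0 GF.
have [HS Hd] := faber_krahn_SLO K0 D0 hn0 HF.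
have [[GC _] [HC _]] := (GF, HF).
have isoH := class_SLO_isomorphic K0 D0 hn0 HC HS Hd.
apply: isomorphic_trans (class_SLO_isomorphic K0 D0 hn0 GC GS Gd) _.
by rewrite (edges_eq G H GC HC); exact: isomorphic_sym.
Qed.
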